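(* Let $E/\mathbb{F}_2$ be the elliptic curve $y^2+y=x^3$. Then $j(E)=0$ and $E$ has exactly $24$ automorphisms (over $\overline{\mathbb{F}_2}$). These are described as $$\Phi_{u,r,t}\colon E\longrightarrow E,\qquad (x,y)\longmapsto (u^2x+r,\; y+u^2r^2x+t),$$ where $u\in\mathbb{F}_4^*$, $r\in\mathbb{F}_4$ and $t^2+t+r^3=0$. Let $n\ge 1$ and $q=2^n$. The action of the Galois group $\mathrm{G}_{\overline{\mathbb{F}_q}/\mathbb{F}_q}$ on $\mathrm{Aut}_{\overline{\mathbb{F}_q}}(E)$ is trivial in case $n$ is even, and nontrivial if $n$ is odd. Let $\omega\in\mathbb{F}_4$ be a chosen primitive third root of unity. (a) In case $n$ is odd, there are exactly three Frobenius conjugacy classes $C_{u,r,t}$ in $\mathrm{Aut}_{\overline{\mathbb{F}_q}}(E)$, namely the class $C_{1,0,0}$ containing the identity, the class $C_{1,\omega,\omega}$ containing $\Phi_{1,\omega,\omega}$, and the class $C_{1,\omega,\omega^2}$ containing $\Phi_{1,\omega,\omega^2}$. The two Frobenius conjugacy classes corresponding to non-trivial twists of $E$ over $\mathbb{F}_q$ yield twists of $E$ over $\mathbb{F}_q$ which are isomorphic to $E$ over a degree eight extension of $\mathbb{F}_q$. (b) In case $n$ is even, the Frobenius conjugacy classes coincide with the usual conjugacy classes in $\mathrm{Aut}_{\overline{\mathbb{F}_q}}(E)$, which are (with $C_{u,r,t}$ denoting the conjugacy class containing $\Phi_{u,r,t}$) $$C_{1,0,0},\ C_{1,0,1},\ C_{\omega^2,0,1},\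 C_{\omega,0,1},\ C_{\omega,0,0},\ C_{\omega^2,0,0},\ C_{1,1,\omega}.$$ The twists of $E/\mathbb{F}_q$ corresponding to these conjugacy classes are isomorphic to $E$ over an extension of $\mathbb{F}_q$ of degree $1,2,6,6,3,3,4$, respectively. In particular $E/\mathbb{F}_{2^n}$ has two non-trivial twists if $n$ is odd, and six non-trivial twists in case $n$ is even.
   Context: A twist of an elliptic curve $E/K$ is an elliptic curve $E^{\mathrm{tw}}/K$ that is isomorphic to $E$ over $\overline{K}$; two twists are considered equal if they are isomorphic over $K$, and a twist is trivial if it is isomorphic to $E$ over $K$. $\mathrm{G}_{\overline{K}/K}$ denotes the absolute Galois group. For $K=\mathbb{F}_q$, $\mathrm{Fr}$ denotes the automorphism of $\overline{\mathbb{F}_q}$ raising every element to its $q$-th power; it acts on morphisms by acting on the coefficients of the defining rational functions. For $\tau\in\mathrm{Aut}_{\overline{\mathbb{F}_q}}(E)$, the Frobenius conjugacy class of $\tau$ is $\{\sigma^{-1}\tau({}^{\mathrm{Fr}}\sigma)\mid\sigma\in\mathrm{Aut}_{\overline{\mathbb{F}_q}}(E)\}$. The twists of $E/\mathbb{F}_q$ are in one-to-one correspondence with the Frobenius conjugacy classes in $\mathrm{Aut}_{\overline{\mathbb{F}_q}}(E)$: a twist $E^{\mathrm{tw}}$ with isomorphism $\psi\colon E\to E^{\mathrm{tw}}$ over $\overline{\mathbb{F}_q}$ corresponds to the Frobenius conjugacy class containing $({}^{\mathrm{Fr}}\psi)^{-1}\circ\psi$. *)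

(* Defs.v *)
From HB Require Import structures.
From mathcomp Require Import all_boot all_order all_fingroup all_algebra.
From mathcomp Require Import all_solvable all_field.
From mathcomp Require Import mpoly ring.

Set Implicit Arguments.
Unset Strict Implicit.
Unset Printing Implicit Defensive.

Import GRing.Theory.
Local Open Scope ring_scope.

(* y^2 + a1 x y + a3 y = x^3 + a2 x^2 + a4 x + a6 *)
Record weierstrass (R : Type) := Weierstrass {
  wa1 : R; wa2 : R; wa3 : R; wa4 : R; wa6 : R }.

Definition map_weierstrass (R S : Type) (f : R -> S) (E : weierstrass R) :=
  Weierstrass (f (wa1 E)) (f (wa2 E)) (f (wa3 E)) (f (wa4 E)) (f (wa6 E)).

Section Invariants.
Variables (K : fieldType) (E : weierstrass K).

Definition wb2 : K := wa1 E ^+ 2 + 4 * wa2 E.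
Definition wb4 : K := 2 * wa4 E + wa1 E * wa3 E.
Definition wb6 : K := wa3 E ^+ 2 + 4 * wa6 E.
Definition wb8 : K :=
  wa1 E ^+ 2 * wa6 E + 4 * wa2 E * wa6 E - wa1 E * wa3 E * wa4 E
  + wa2 E * wa3 E ^+ 2 - wa4 E ^+ 2.
Definition wc4 : K := wb2 ^+ 2 - 24 * wb4.
Definition discriminant : K :=
  - wb2 ^+ 2 * wb8 - 8 * wb4 ^+ 3 - 27 * wb6 ^+ 2 + 9 * wb2 * wb4 * wb6.
Definition j_invariant : K := wc4 ^+ 3 / discriminant.

Definition elliptic : bool := discriminant != 0.

End Invariants.

(* None is the point O = [0 : 1 : 0], the only point at infinity of a
   Weierstrass cubic, and Some (x, y) is [x : y : 1]. *)
Definition on_curve (L : fieldType) (E : weierstrass L) (P : option (L * L)) :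
    bool :=
  if P is Some (x, y) then
    y ^+ 2 + wa1 E * x * y + wa3 E * y
      == x ^+ 3 + wa2 E * x ^+ 2 + wa4 E * x + wa6 E
  else true.

(* E(L), for a curve E over K and an embedding iota of K into L *)
Definition point (K L : fieldType) (iota : {rmorphism K -> L})
    (E : weierstrass K) :=
  {P : option (L * L) | on_curve (map_weierstrass iota E) P}.

Definition infinity (K L : fieldType) (iota : {rmorphism K -> L})
    (E : weierstrass K) : point iota E :=
  exist (fun P => on_curve (map_weierstrass iota E) P) None isT.

Definition hcoord (L : fieldType) (P : option (L * L)) : 'I_3 -> L :=
  if P is Some (x, y) then tnth [tuple x; y; 1] else tnth [tuple 0; 1; 0].

Section Morphisms.

(* Points have coordinates in the algebraically closed field L; the morphisms
   below are defined by polynomials with coefficients in F, embedded in L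
   by j. *)
Variables (K L : fieldType) (iota : {rmorphism K -> L}).
Variables (F : fieldType) (j : {rmorphism F -> L}).

Definition heval (G : 'I_3 -> {mpoly F[3]}) (P : option (L * L)) (i : 'I_3) :
    L :=
  (map_mpoly j (G i)).@[hcoord P].

(* phi(Q) = [G_0(Q) : G_1(Q) : G_2(Q)] at every point Q of E where the G_i do
   not all vanish *)
Definition represents (E E' : weierstrass K) (G : 'I_3 -> {mpoly F[3]})
    (phi : point iota E -> point iota E') : Prop :=
  forall Q : point iota E, (exists i, heval G (val Q) i != 0) ->
  exists c : L, forall i, heval G (val Q) i = c * hcoord (val (phi Q)) i.

Definition morphism_over (E E' : weierstrass K)
    (phi : point iota E -> point iota E') : Prop :=
  forall P : point iota E, exists (d : nat) (G : 'I_3 -> {mpoly F[3]}),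
    [/\ forall i, G i \is d.-homog,
        exists i, heval G (val P) i != 0
      & represents G phi].

Definition isomorphism_over (E E' : weierstrass K)
    (phi : point iota E -> point iota E') : Prop :=
  [/\ morphism_over phi,
      phi (infinity iota E) = infinity iota E'
    & exists psi : point iota E' -> point iota E,
        [/\ morphism_over psi, cancel phi psi & cancel psi phi]].

Definition isomorphic_over (E E' : weierstrass K) : Prop :=
  exists phi : point iota E -> point iota E', isomorphism_over phi.

End Morphisms.

Section Galois.
Variables (K L : fieldType) (iota : {rmorphism K -> L}).

(* The Galois group of L over K *)
Record galois_elt := GaloisElt {
  gal_fun :> {rmorphism L -> L};
  gal_inv : L -> L;
  gal_funK : cancel gal_fun gal_inv;
  gal_invK : cancel gal_inv gal_fun;
  gal_fix : forall a, gal_fun (iota a) = iota a }.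

Definition map_coord (f : L -> L) (P : option (L * L)) : option (L * L) :=
  omap (fun xy => (f xy.1, f xy.2)) P.

Variable s : galois_elt.

Lemma on_curve_gal (E : weierstrass K) (P : option (L * L)) :
  on_curve (map_weierstrass iota E) (map_coord s P)
  = on_curve (map_weierstrass iota E) P.
Proof.
case: P => [[x y]|] //=; rewrite -[RHS](inj_eq (can_inj (gal_funK s))).
by rewrite !(rmorphD, rmorphM, rmorphXn) /= !gal_fix.
Qed.

Lemma on_curve_gal_inv (E : weierstrass K) (P : option (L * L)) :
  on_curve (map_weierstrass iota E) (map_coord (gal_inv s) P)
  = on_curve (map_weierstrass iota E) P.
Proof.
by rewrite -on_curve_gal; case: P => [[x y]|] //=; rewrite !gal_invK.
Qed.

Definition gal_point (E : weierstrass K) (P : point iota E) : point iota E :=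
  exist (fun Q => on_curve (map_weierstrass iota E) Q) (map_coord s (val P))
    (etrans (on_curve_gal E (val P)) (valP P)).

Definition gal_point_inv (E : weierstrass K) (P : point iota E) :
    point iota E :=
  exist (fun Q => on_curve (map_weierstrass iota E) Q)
    (map_coord (gal_inv s) (val P))
    (etrans (on_curve_gal_inv E (val P)) (valP P)).

(* The action of s on morphisms, ^s phi = s o phi o s^-1.  By represents_conj
   below this is the action of s on the coefficients of the polynomials
   representing phi. *)
Definition gal_conj (E E' : weierstrass K)
    (phi : point iota E -> point iota E') : point iota E -> point iota E' :=
  fun P => gal_point (phi (gal_point_inv P)).

Lemma hcoord_gal (f : {rmorphism L -> L}) (P : option (L * L)) i :
  hcoord (map_coord f P) i = f (hcoord P i).
Proof.
by case: P => [[x y]|]; case: i => [[|[|[|i]]] // lt_i];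
  rewrite /= !(tnth_nth 0) /= ?rmorph0 ?rmorph1.
Qed.

Lemma gal_point_invK (E : weierstrass K) (P : point iota E) :
  gal_point (gal_point_inv P) = P.
Proof. by apply: val_inj => /=; case: P => -[[x y]|] //= _; rewrite !gal_invK. Qed.

Lemma meval_map (f : {rmorphism L -> L}) (p : {mpoly L[3]}) (v : 'I_3 -> L) :
  (map_mpoly f p).@[f \o v] = f p.@[v].
Proof.
rewrite !mevalE rmorph_sum (perm_big _ (msupp_map_mpoly p (fmorph_inj f))) /=.
apply: eq_bigr => m _; rewrite mcoeff_map_mpoly rmorphM rmorph_prod.
by congr (_ * _); apply: eq_bigr => i _; rewrite /= rmorphXn.
Qed.

Lemma heval_gal (G : 'I_3 -> {mpoly L[3]}) (P : option (L * L)) i :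
  heval idfun (fun i => map_mpoly s (G i)) (map_coord s P) i
  = s (heval idfun G P i).
Proof.
rewrite /heval -meval_map.
rewrite (@meval_eq _ _ _ (s \o hcoord P) _ (fun i => hcoord_gal s P i)).
by congr meval; apply/mpolyP => m; rewrite !mcoeff_map_mpoly.
Qed.

Lemma represents_conj (E E' : weierstrass K) (G : 'I_3 -> {mpoly L[3]})
    (phi : point iota E -> point iota E') :
  represents idfun G phi ->
  represents idfun (fun i => map_mpoly s (G i)) (gal_conj phi).
Proof.
move=> Gphi Q; rewrite -{1 2}(gal_point_invK Q); set P := gal_point_inv Q.
case=> i; rewrite heval_gal fmorph_eq0 => nz_i.
have [c cP] := Gphi P (ex_intro _ i nz_i).
by exists (s c) => k; rewrite heval_gal cP rmorphM hcoord_gal.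
Qed.

End Galois.

Section Frobenius.
Variables (K : finFieldType) (L : closedFieldType) (iota : {rmorphism K -> L}).

Definition frob_fun of {rmorphism K -> L} := fun x : L => x ^+ #|K|.

Lemma frob_funD (x y : L) : frob_fun iota (x + y) = frob_fun iota x + frob_fun iota y.
Proof.
have [p _ pK] := finPcharP K; apply: exprDn_pchar.
have pL : p \in [pchar L] by rewrite (fmorph_pchar iota).
rewrite (eq_pnat _ (pcharf_eq pL)) (card_pprimeChar pK) pnatX.
by rewrite pnat_id ?(pcharf_prime pK).
Qed.

Lemma frob_funB : zmod_morphism (frob_fun iota).
Proof.
move=> x y; apply: (addIr (frob_fun iota y)).
by rewrite -frob_funD !subrK.
Qed.

Lemma frob_funM : monoid_morphism (frob_fun iota).
Proof. by split=> [|x y]; rewrite /frob_fun ?expr1n ?exprMn. Qed.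

HB.instance Definition _ :=
  GRing.isZmodMorphism.Build L L (frob_fun iota) frob_funB.
HB.instance Definition _ :=
  GRing.isMonoidMorphism.Build L L (frob_fun iota) frob_funM.

Lemma frob_root (x : L) : exists y, frob_fun iota y == x.
Proof.
have [y yx] := @solve_monicpoly L #|K| (fun i => if i == 0%N then x else 0)
  (ltnW (finNzRing_gt1 K)).
exists y; rewrite /frob_fun yx -(prednK (ltnW (finNzRing_gt1 K))).
by rewrite big_ord_recl /= expr0 mulr1 big1 ?addr0 // => i _; rewrite mul0r.
Qed.

Definition frob_inv (x : L) : L := xchoose (frob_root x).

Lemma frob_invK : cancel frob_inv (frob_fun iota).
Proof. by move=> x; apply/eqP/(xchooseP (frob_root x)). Qed.

Lemma frob_funK : cancel (frob_fun iota) frob_inv.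
Proof. by move=> x; apply: (fmorph_inj (frob_fun iota)); exact: frob_invK. Qed.

Lemma frob_fix (a : K) : frob_fun iota (iota a) = iota a.
Proof. by rewrite /frob_fun -rmorphXn /= expf_card. Qed.

(* Fr : x |-> x ^+ #|K| *)
Definition frobenius : galois_elt iota :=
  @GaloisElt K L iota (frob_fun iota) frob_inv frob_funK frob_invK frob_fix.

End Frobenius.

Section Twists.
Variables (K : finFieldType) (L : closedFieldType) (iota : {rmorphism K -> L}).

Definition geom_isomorphism (E E' : weierstrass K)
    (phi : point iota E -> point iota E') : Prop :=
  isomorphism_over (idfun : {rmorphism L -> L}) phi.

Definition automorphism (E : weierstrass K) (phi : point iota E -> point iota E)
  : Prop := geom_isomorphism phi.

Definition conj_class (E : weierstrass K) (tau phi : point iota E -> point iota E)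
  : Prop :=
  exists sigma sigma_inv : point iota E -> point iota E,
    [/\ automorphism sigma, cancel sigma sigma_inv, cancel sigma_inv sigma
      & phi =1 sigma_inv \o tau \o sigma].

Definition frob_class (E : weierstrass K) (tau phi : point iota E -> point iota E)
  : Prop :=
  exists sigma sigma_inv : point iota E -> point iota E,
    [/\ automorphism sigma, cancel sigma sigma_inv, cancel sigma_inv sigma
      & phi =1 sigma_inv \o tau \o gal_conj (frobenius iota) sigma].

Definition rational_isomorphic (E E' : weierstrass K) : Prop :=
  isomorphic_over iota iota E E'.

Definition is_twist (E Etw : weierstrass K) : Prop :=
  elliptic Etw /\ isomorphic_over iota (idfun : {rmorphism L -> L}) E Etw.

Definition nontrivial_twist (E Etw : weierstrass K) : Prop :=
  is_twist E Etw /\ ~ rational_isomorphic E Etw.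

Definition corresponds (E : weierstrass K) (tau : point iota E -> point iota E)
    (Etw : weierstrass K) : Prop :=
  is_twist E Etw /\
  exists (psi : point iota E -> point iota Etw)
         (psiFr_inv : point iota Etw -> point iota E),
    [/\ geom_isomorphism psi,
        cancel (gal_conj (frobenius iota) psi) psiFr_inv,
        cancel psiFr_inv (gal_conj (frobenius iota) psi)
      & frob_class tau (psiFr_inv \o psi)].

(* E and E' become isomorphic over an extension of K of degree d in L *)
Definition isomorphic_in_degree (E E' : weierstrass K) (d : nat) : Prop :=
  exists (F : fieldExtType K) (j : {rmorphism F -> L}),
    [/\ \dim {:F} = d, forall a : K, j a%:A = iota a
      & isomorphic_over iota j E E'].

(* The twists corresponding to the class of tau become isomorphic to E over an
   extension of degree d and over no extension of smaller degree. *)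
Definition twist_degree (E : weierstrass K) (tau : point iota E -> point iota E)
    (d : nat) : Prop :=
  (exists Etw, corresponds tau Etw) /\
  forall Etw, corresponds tau Etw ->
    isomorphic_in_degree E Etw d /\
    forall e, isomorphic_in_degree E Etw e -> (d <= e)%N.

End Twists.

(* Up to R, the elements satisfying A are exactly the m entries of c, which are
   pairwise inequivalent (when R is reflexive). *)
Definition representatives (T : Type) (A : T -> Prop) (R : T -> T -> Prop)
    (m : nat) (c : m.-tuple T) : Prop :=
  (forall i, A (tnth c i)) /\
  forall x, A x -> exists! i, R x (tnth c i).

Definition same_class (T : Type) (class : T -> T -> Prop) (x y : T) : Prop :=
  forall z, class x z <-> class y z.

(* y^2 + y = x^3 *)
Definition curve (R : nzRingType) : weierstrass R := Weierstrass 0 0 1 0 0.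

Section Phi.
Variables (K L : fieldType) (iota : {rmorphism K -> L}).

Definition Phi_formula (u r t : L) (P : option (L * L)) : option (L * L) :=
  omap (fun xy => (u ^+ 2 * xy.1 + r, xy.2 + u ^+ 2 * r ^+ 2 * xy.1 + t)) P.

(* u in F_4^*, r in F_4 and t^2 + t + r^3 = 0, where F_4 = {x | x^4 = x} *)
Definition Phi_valid (u r t : L) : bool :=
  [&& u != 0, u ^+ 4 == u, r ^+ 4 == r & t ^+ 2 + t + r ^+ 3 == 0].

(* insubd makes Phi total in (u, r, t): in characteristic 2, for valid
   parameters, the formula maps the curve to itself and the default value P is
   never used (see val_Phi). *)
Definition Phi (u r t : L) (P : point iota (curve K)) : point iota (curve K) :=
  insubd P (Phi_formula u r t (val P)).

Lemma val_Phi (u r t : L) (P : point iota (curve K)) :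
  2 \in [pchar L] -> Phi_valid u r t ->
  val (Phi u r t P) = Phi_formula u r t (val P).
Proof.
move=> L2 /and4P[nz_u /eqP u4 /eqP r4 /eqP tr]; rewrite val_insubd.
case: ifP => // /negP[]; case: P => -[[x y]|] //=.
rewrite !(rmorph0, rmorph1, mul0r, addr0, mul1r) => /eqP xy.
have u3 : u ^+ 3 = 1 by apply: (mulfI nz_u); rewrite -exprS u4 mulr1.
apply/eqP/subr0_eq; set v := y + _ + _; set w := _ + r.
have -> : v ^+ 2 + v - w ^+ 3
    = (y ^+ 2 + y - x ^+ 3) - (u ^+ 3 - 1) * (u ^+ 3 + 1) * x ^+ 3
      + u ^+ 4 * x ^+ 2 * (r ^+ 4 - r) + (t ^+ 2 + t + r ^+ 3)
      + 2 * (y * u ^+ 2 * r ^+ 2 * x + y * t + u ^+ 2 * r ^+ 2 * x * t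
             - u ^+ 4 * x ^+ 2 * r - u ^+ 2 * x * r ^+ 2 - r ^+ 3).
  by rewrite /v /w; ring.
by rewrite xy u3 r4 tr (pcharf0 L2) !subrr !(mul0r, mulr0) subrr !addr0.
Qed.

End Phi.

Arguments Phi {K L} iota u r t P.

(* Main.v *)
Require Import Defs.
From mathcomp Require Import all_boot all_order all_fingroup all_algebra.
From mathcomp Require Import all_solvable all_field.
From mathcomp Require Import mpoly ring zify.

(** An isomorphism between two Weierstrass curves that fixes the point O at
    infinity is a change of coordinates (x, y) |-> (a x + r, c y + s x + t).
    The proof of this is the geometric heart of the matter.  The coordinates of
    the image of a point are regular functions away from O.  A regular function
    is a polynomial a(x) + b(x) y ([regular_polyfun]), because its denominators
    form an ideal without a common zero.  The order of the pole of a + b y at O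
    is the degree of its norm to the line, so it is additive on products and
    can be computed.  The equation of the target curve forces the two
    coordinates of the image to have poles of orders 2k and 3k.  Since x and y,
    with poles of orders 2 and 3, are polynomials in these coordinates, k = 1
    ([linear_form]).

    In characteristic 2, comparing coefficients in y^2 + y = x^3 leaves as
    automorphisms the 24 maps Phi_(u,r,t) ([automorphism_PhiP]), whose
    parameters all lie in F_4.  Hence Frobenius acts trivially on them when F_4
    is contained in F_q, and its square acts trivially in all cases.

    Fields of definition are read off from the Galois action: an isomorphism is
    defined over a finite subfield F of L if and only if it is fixed under
    conjugation by the power map whose fixed field is F ([iso_over_fixedP]).
    So let psi : E -> E' be an isomorphism with psi = (Fr psi) o tau.  Two
    twists are isomorphic over K exactly when their automorphisms tau are
    Frobenius conjugate ([splits_isomorphic]).  The isomorphism psi o alpha is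
    defined over the extension of degree e exactly when Fr^e alpha = N_e alpha,
    where N_e is the product of tau with its first e - 1 conjugates
    ([splits_degree]).  Every automorphism tau occurs, as the required psi is
    found by solving equations of degrees q - 1, 2 and q one after another
    ([lang_curve]).

    If n is even, N_e = tau^e and the degree belonging to tau is its order.  If
    n is odd and tau is one of the two non-trivial representatives, N_2 has
    order 4 and the degree is 8.  It cannot be odd, since an isomorphism over
    the extension of odd degree e forces N_(2e) = (N_2)^e to be the identity.

    All assertions about classes and degrees are now statements about a group
    of order 24 with the action of Frobenius.  They are decided by computation
    on triples of elements of an explicit copy of F_4. *)

Set Implicit Arguments.
Unset Strict Implicit.
Unset Printing Implicit Defensive.

Import GRing.Theory.
Local Open Scope ring_scope.

(** * Polynomial functions on a Weierstrass curve and their poles *)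

(** Restating these facts over a closed field gives each size a single form for
    linear arithmetic. *)
Lemma size_mul_closed (L : closedFieldType) (p q : {poly L}) :
  p != 0 -> q != 0 -> size (p * q) = (size p + size q).-1.
Proof. exact: size_mul. Qed.

Lemma size_mul_leq_closed (L : closedFieldType) (p q : {poly L}) :
  (size (p * q)%R <= (size p + size q).-1)%N.
Proof. exact: size_polyMleq. Qed.

Lemma size_add_leq_closed (L : closedFieldType) (p q : {poly L}) :
  (size (p + q)%R <= maxn (size p) (size q))%N.
Proof. exact: size_polyD. Qed.

Lemma size_gt0_closed (L : closedFieldType) (p : {poly L}) :
  (0 < size p)%N = (p != 0).
Proof. exact: size_poly_gt0. Qed.

Section AffineFunctions.
Variables (L : closedFieldType) (W : weierstrass L).

Definition on_affine (x y : L) : bool := on_curve W (Some (x, y)).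

Definition lin_part : {poly L} := wa1 W *: 'X + (wa3 W)%:P.
Definition sub_cubic : {poly L} := wa2 W *: 'X^2 + wa4 W *: 'X + (wa6 W)%:P.
Definition cubic : {poly L} := 'X^3 + sub_cubic.

Lemma on_affineE x y :
  on_affine x y = (y ^+ 2 + lin_part.[x] * y == cubic.[x]).
Proof.
rewrite /on_affine /= /lin_part /cubic /sub_cubic !hornerE mulrDl !addrA.
by [].
Qed.

Lemma quadratic_root (b c : L) : exists y, y ^+ 2 + b * y = c.
Proof.
have [y yP] := @solve_monicpoly L 2 (fun i => if i == 0%N then c else - b) isT.
exists y; rewrite yP !big_ord_recl big_ord0 /=; ring.
Qed.

Lemma exists_affine x : exists y, on_affine x y.
Proof.
have [y yP] := quadratic_root lin_part.[x] cubic.[x].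
by exists y; rewrite on_affineE yP.
Qed.

(** The second coordinate of the opposite of the point (x, y), that is, the
    other solution of the equation of W above x. *)
Definition opp_y (x y : L) := - y - lin_part.[x].

Lemma on_affine_opp x y : on_affine x y -> on_affine x (opp_y x y).
Proof.
rewrite !on_affineE /opp_y => /eqP <-; apply/eqP; ring.
Qed.

(** The norm of a + b y from the function field of W to the field of rational
    functions of x. *)
Definition poly_norm (a b : {poly L}) :=
  a ^+ 2 - a * b * lin_part - b ^+ 2 * cubic.

Lemma horner_norm a b x y : on_affine x y ->
  (poly_norm a b).[x] = (a.[x] + b.[x] * y) * (a.[x] + b.[x] * opp_y x y).
Proof.
rewrite on_affineE /poly_norm /opp_y; move: lin_part cubic => l c /eqP yP.
rewrite !(hornerD, hornerN, hornerM, horner_exp) -yP; ring.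
Qed.

Lemma size_sub_cubic : (size sub_cubic <= 3)%N.
Proof.
rewrite /sub_cubic; apply: leq_trans (size_add_leq_closed _ _) _;
  rewrite geq_max.
rewrite (leq_trans (size_polyC_leq1 _)) // andbT.
apply: leq_trans (size_add_leq_closed _ _) _; rewrite geq_max.
by rewrite !(leq_trans (size_scale_leq _ _)) ?size_polyXn ?size_polyX.
Qed.

Lemma size_lin_part : (size lin_part <= 2)%N.
Proof.
rewrite /lin_part; apply: leq_trans (size_add_leq_closed _ _) _;
  rewrite geq_max.
rewrite (leq_trans (size_polyC_leq1 _)) // andbT.
by rewrite (leq_trans (size_scale_leq _ _)) ?size_polyX.
Qed.

Definition norm_size (a b : {poly L}) :=
  maxn (size (a ^+ 2)) (size (b ^+ 2 * 'X^3)).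

(** The degree of a^2 is even and that of b^2 cubic is odd, so that they do not
    cancel, and the larger of the two exceeds the degrees of all other terms. *)
Lemma size_norm a b : size (poly_norm a b) = norm_size a b.
Proof.
have sqr (p : {poly L}) : size (p ^+ 2) = (size p).*2.-1.
  have [->|nz] := eqVneq p 0; first by rewrite expr0n size_poly0.
  by rewrite expr2 size_mul_closed // addnn.
have cub (p : {poly L}) :
  size (p ^+ 2 * 'X^3) = if p == 0 then 0%N else (size p).*2.+2.
  have [->|nz] := eqVneq p 0; first by rewrite expr0n mul0r size_poly0.
  rewrite size_mulXn ?expf_neq0 // sqr.
  by move: nz; rewrite -size_gt0_closed; lia.
have -> : poly_norm a b =
  a ^+ 2 + - (b ^+ 2 * 'X^3) + - (a * b * lin_part + b ^+ 2 * sub_cubic).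
  by rewrite /poly_norm /cubic; ring.
have small : ((a == 0) && (b == 0)) ||
  (size (a * b * lin_part + b ^+ 2 * sub_cubic)%R < norm_size a b)%N.
  have [->|nzb] := eqVneq b 0.
    rewrite expr0n !(mulr0, mul0r) addr0 size_poly0 andbT.
    have [//|nza] := eqVneq a 0.
    by rewrite leq_max size_gt0_closed expf_neq0.
  rewrite andbF /=; apply: leq_ltn_trans (size_add_leq_closed _ _) _.
  have s1 := size_lin_part; have s2 := size_sub_cubic.
  have nb : (0 < size b)%N by rewrite size_gt0_closed.
  have h1 : (size (b ^+ 2 * sub_cubic)%R <= (size b).*2.+1)%N.
    by apply: leq_trans (size_mul_leq_closed _ _) _; rewrite sqr; lia.
  rewrite /norm_size cub (negPf nzb) sqr gtn_max.
  have [->|nza] := eqVneq a 0; first by rewrite !mul0r size_poly0 leq_max; lia.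
  have na : (0 < size a)%N by rewrite size_gt0_closed.
  have h2 : (size (a * b * lin_part)%R <= size a + size b)%N.
    by apply: leq_trans (size_mul_leq_closed _ _) _;
      rewrite (size_mul_closed nza nzb); lia.
  by lia.
have main : size (a ^+ 2 + - (b ^+ 2 * 'X^3)) = norm_size a b.
  rewrite /norm_size.
  have : size (a ^+ 2) != size (b ^+ 2 * 'X^3) \/ a = 0 /\ b = 0.
    rewrite cub sqr; have [->|nzb] := eqVneq b 0.
      have [->|] := eqVneq a 0; first by right.
      by rewrite -size_gt0_closed; left; lia.
    by left; lia.
  case=> [|[-> ->]]; last by rewrite !expr0n mul0r subr0 size_poly0.
  case: ltngtP => // lt_ab _.
  - by rewrite addrC size_polyDl size_polyN //.
  - by rewrite size_polyDl ?size_polyN //.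
case/orP: small => [/andP[/eqP a0 /eqP b0]|small].
  by rewrite a0 b0 /norm_size !expr0n !(mul0r, mulr0, addr0, oppr0) size_poly0.
by rewrite size_polyDl main // size_polyN.
Qed.

Lemma norm_eq0 a b : poly_norm a b = 0 -> a = 0 /\ b = 0.
Proof.
move=> /(congr1 (fun p : {poly L} => size p));
  rewrite size_norm size_poly0 /norm_size => s0.
have /eqP : size (a ^+ 2) = 0%N by lia.
have /eqP : size (b ^+ 2 * 'X^3) = 0%N by lia.
rewrite !size_poly_eq0 mulf_eq0 !expf_eq0 polyX_eq0 /= orbF.
by move=> /eqP-> /eqP->.
Qed.

(** If p vanishes everywhere, then p + 1 has no root and is constant. *)
Lemma closed_horner0 (p : {poly L}) : (forall x, p.[x] = 0) -> p = 0.
Proof.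
move=> p0; have [/closed_rootP[x]|] := boolP (size (p + 1) != 1%N).
  by rewrite /root !hornerE p0 add0r oner_eq0.
rewrite negbK => /size_poly1P[c _ pc]; have := p0 0.
have -> : p = (c - 1)%:P by rewrite rmorphB /= -pc addrK.
by rewrite hornerC => ->.
Qed.

Definition represented (a b : {poly L}) (f : L -> L -> L) :=
  forall x y, on_affine x y -> f x y = a.[x] + b.[x] * y.

(** The norm of the difference of two representations vanishes at every x. *)
Lemma represented_inj a b a' b' f :
  represented a b f -> represented a' b' f -> a = a' /\ b = b'.
Proof.
move=> fab fab'; suff [] : a - a' = 0 /\ b - b' = 0.
  by move/subr0_eq->; move/subr0_eq->.
apply: norm_eq0; apply: closed_horner0 => x; have [y xy] := exists_affine x.
rewrite (horner_norm _ _ xy) !hornerE.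
rewrite (_ : (a.[x] - a'.[x] + (b.[x] - b'.[x]) * y) = 0) ?mul0r //.
by rewrite mulrBl addrACA -opprD -fab // -fab' // subrr.
Qed.

(** The functions a(x) + b(x) y form the coordinate ring of W. The order of the
    pole at infinity of such a function is the degree of its norm, since the
    norm is the product of the function with its conjugate, which has a pole of
    the same order. *)
Definition polyfun f := exists a b, represented a b f.
Definition pole f (d : nat) := exists a b, represented a b f /\
  size (poly_norm a b) = d.+1.
Definition pole_le f (d : nat) := exists a b, represented a b f /\
  (size (poly_norm a b) <= d.+1)%N.

Lemma eq_represented a b f g : (forall x y, on_affine x y -> f x y = g x y) ->
  represented a b g -> represented a b f.
Proof. by move=> fg gab x y xy; rewrite fg // gab. Qed.

Lemma represented_add a b a' b' f g :
  represented a b f -> represented a' b' g ->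
  represented (a + a') (b + b') (fun x y => f x y + g x y).
Proof.
by move=> fab gab x y xy; rewrite fab // gab // !hornerD mulrDl addrACA.
Qed.

Lemma represented_mul a b a' b' f g :
  represented a b f -> represented a' b' g ->
  represented (a * a' + b * b' * cubic) (a * b' + a' * b - b * b' * lin_part)
    (fun x y => f x y * g x y).
Proof.
move=> fab gab x y xy; rewrite fab // gab //.
move: xy; rewrite on_affineE; move: lin_part cubic => l c /eqP yP.
by rewrite !(hornerD, hornerN, hornerM) -yP; ring.
Qed.

Lemma norm_mul a b a' b' :
  poly_norm (a * a' + b * b' * cubic) (a * b' + a' * b - b * b' * lin_part)
  = poly_norm a b * poly_norm a' b'.
Proof. by rewrite /poly_norm; ring. Qed.

Lemma size_norm_add a b a' b' : (size (poly_norm (a + a')%R (b + b')%R) <=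
  maxn (size (poly_norm a b)) (size (poly_norm a' b')))%N.
Proof.
rewrite !size_norm /norm_size.
have mono (p q : {poly L}) k :
  (size ((p + q) ^+ 2 * 'X^k)%R <=
  maxn (size (p ^+ 2 * 'X^k)%R) (size (q ^+ 2 * 'X^k)%R))%N.
  wlog pq : p q / (size p <= size q)%N.
    by move=> IH; case/orP: (leq_total (size p) (size q)) => /IH //;
      rewrite addrC maxnC.
  rewrite leq_max; apply/orP; right.
  have [->|nz] := eqVneq (p + q) 0; first by rewrite expr0n mul0r size_poly0.
  have nzq : q != 0.
    apply: contraNneq nz => q0; move: pq;
      rewrite q0 size_poly0 leqn0 size_poly_eq0.
    by move/eqP->; rewrite addr0.
  rewrite !size_mulXn ?expf_neq0 // leq_add2l !expr2 !size_mul_closed //.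
  have := size_add_leq_closed p q; rewrite (maxn_idPr pq).
  lia.
have m1 := mono a a' 0%N; rewrite expr0 !mulr1 in m1.
by rewrite maxnACA geq_max (leq_trans m1 (leq_maxl _ _))
  (leq_trans (mono b b' 3) (leq_maxr _ _)).
Qed.

Lemma pole_uniq f d e : pole f d -> pole f e -> d = e.
Proof.
move=> [a [b [fab s]]] [a' [b' [fab' s']]].
have [ea eb] := represented_inj fab fab'; move: s s'; rewrite ea eb.
by move=> -> [].
Qed.

Lemma pole_polyfun f d : pole f d -> polyfun f.
Proof. by case=> a [b [fab _]]; exists a, b. Qed.

Lemma eq_pole f g d : (forall x y, on_affine x y -> f x y = g x y) ->
  pole f d -> pole g d.
Proof.
move=> fg [a [b [fab s]]]; exists a, b; split => //.
by apply: eq_represented fab => x y xy; rewrite fg.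
Qed.

Lemma poleW f d e : (d <= e)%N -> pole f d -> pole_le f e.
Proof. by move=> de [a [b [fab s]]]; exists a, b; rewrite s. Qed.

Lemma pole_leW f d e : (d <= e)%N -> pole_le f d -> pole_le f e.
Proof. by move=> de [a [b [fab s]]]; exists a, b; split => //; lia. Qed.

Lemma pole_le_add f g d : pole_le f d -> pole_le g d ->
  pole_le (fun x y => f x y + g x y) d.
Proof.
move=> [a [b [fab s]]] [a' [b' [gab s']]]; exists (a + a'), (b + b'); split.
  exact: represented_add.
by apply: leq_trans (size_norm_add _ _ _ _) _; rewrite geq_max s.
Qed.

Lemma pole_le_mul f g d e : pole_le f d -> pole_le g e ->
  pole_le (fun x y => f x y * g x y) (d + e).
Proof.
move=> [a [b [fab s]]] [a' [b' [gab s']]]; eexists; eexists; split.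
  exact: represented_mul fab gab.
rewrite norm_mul; apply: leq_trans (size_mul_leq_closed _ _) _; lia.
Qed.

Lemma pole_mul f g d e : pole f d -> pole g e ->
  pole (fun x y => f x y * g x y) (d + e).
Proof.
move=> [a [b [fab s]]] [a' [b' [gab s']]]; eexists; eexists; split.
  exact: represented_mul fab gab.
rewrite norm_mul size_mul_closed -?size_gt0_closed ?s ?s' //; lia.
Qed.

Lemma represented_const (c : L) : represented c%:P 0 (fun _ _ => c).
Proof. by move=> x y _; rewrite hornerC horner0 mul0r addr0. Qed.

Lemma pole_const c : c != 0 -> pole (fun _ _ => c) 0.
Proof.
move=> nz; exists c%:P, 0; split; first exact: represented_const.
by rewrite size_norm /norm_size -rmorphXn /= size_polyC expf_neq0 // expr0n
  mul0r size_poly0.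
Qed.

Lemma pole_le_const c d : pole_le (fun _ _ => c) d.
Proof.
exists c%:P, 0; split; first exact: represented_const.
rewrite size_norm /norm_size -rmorphXn /= expr0n mul0r size_poly0 maxn0.
by rewrite (leq_trans (size_polyC_leq1 _)).
Qed.

Lemma pole_add f g d e : (e < d)%N -> pole f d -> pole_le g e ->
  pole (fun x y => f x y + g x y) d.
Proof.
move=> ed [a [b [fab s]]] [a' [b' [gab s']]]; exists (a + a'), (b + b'); split.
  exact: represented_add.
have := size_norm_add a b a' b';
  have := size_norm_add (a + a') (b + b') (- a') (- b').
rewrite !addrK.
have -> : poly_norm (- a') (- b') = poly_norm a' b' by rewrite /poly_norm; ring.
by rewrite s; lia.
Qed.

Lemma not_pole0 f d : (forall x y, on_affine x y -> f x y = 0) -> ~ pole f d.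
Proof.
move=> f0 [a [b [fab]]].
have f00 : represented 0 0 f by move=> x y xy;
  rewrite f0 // !horner0 mul0r addr0.
have [-> ->] := represented_inj fab f00.
by rewrite size_norm /norm_size expr0n mul0r size_poly0.
Qed.

Lemma polyfun_pole f : polyfun f ->
  (forall x y, on_affine x y -> f x y = 0) \/ exists d, pole f d.
Proof.
move=> [a [b fab]]; case E : (size (poly_norm a b)) => [|d].
  left; move/eqP: E; rewrite size_poly_eq0 => /eqP/norm_eq0[a0 b0] x y xy.
  by rewrite fab // a0 b0 !horner0 mul0r addr0.
by right; exists d, a, b.
Qed.

Lemma pole_x : pole (fun x _ => x) 2.
Proof.
exists 'X, 0; split; first by move=> x y _; rewrite hornerX horner0 mul0r addr0.
by rewrite size_norm /norm_size size_polyXn expr0n mul0r size_poly0.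
Qed.

Lemma pole_y : pole (fun _ y => y) 3.
Proof.
exists 0, 1; split; first by move=> x y _; rewrite horner0 hornerC mul1r add0r.
by rewrite size_norm /norm_size expr0n expr1n mul1r size_poly0 size_polyXn.
Qed.

Lemma sizes_of_norm a b d : size (poly_norm a b) = d.+1 ->
  ((size a).*2.-1 <= d.+1)%N /\ (b == 0) || ((size b).*2.+1 <= d)%N.
Proof.
rewrite size_norm => s.
have sqr (p : {poly L}) : size (p ^+ 2) = (size p).*2.-1.
  have [->|nz] := eqVneq p 0; first by rewrite expr0n size_poly0.
  by rewrite expr2 size_mul_closed // addnn.
split; first by rewrite -s -sqr leq_maxl.
case: eqVneq => //= nz.
have : ((size b).*2.+2 <= d.+1)%N.
  rewrite -s; apply: leq_trans (leq_maxr _ _).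
  rewrite size_mulXn ?expf_neq0 // sqr.
  by move: nz; rewrite -size_gt0_closed; lia.
by [].
Qed.

Lemma size2_linear (a : {poly L}) : (size a <= 2)%N ->
  a = (a`_0)%:P + a`_1 *: 'X.
Proof.
move=> sa; apply/polyP => -[|[|i]];
  rewrite coefD coefC coefZ coefX /= ?mulr0 ?addr0 ?add0r ?mulr1 //.
by rewrite nth_default // (leq_trans sa).
Qed.

(** The functions whose only pole is at O and has order at most 2 are spanned by
    1 and x. *)
Lemma pole2 f : pole f 2 ->
  exists a r, a != 0 /\ forall x y, on_affine x y -> f x y = a * x + r.
Proof.
move=> [a [b [fab s]]]; have [sa sb] := sizes_of_norm s.
have b0 : b = 0.
  apply: contraTeq sb => nz; rewrite negb_or nz.
  by move: nz; rewrite -size_gt0_closed; lia.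
have sa2 : (size a <= 2)%N by lia.
have ea := size2_linear sa2; rewrite {}b0 in fab s.
exists a`_1, a`_0; split.
  apply: contra_eqN s => /eqP a10;
    rewrite ea a10 scale0r addr0 size_norm /norm_size.
  rewrite -rmorphXn expr0n mul0r size_poly0 maxn0 /=.
  by case: eqVneq (size_polyC_leq1 (a`_0 ^+ 2)) => // ->.
by move=> x y xy; rewrite fab // [in LHS]ea hornerD hornerC hornerZ hornerX
  horner0 mul0r addr0 addrC.
Qed.

(** The functions whose only pole is at O and has order at most 3 are spanned by
    1, x and y. *)
Lemma pole3 f : pole f 3 ->
  exists c s t, c != 0 /\ forall x y, on_affine x y ->
    f x y = c * y + s * x + t.
Proof.
move=> [a [b [fab s]]]; have [sa sb] := sizes_of_norm s.
have nzb : b != 0.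
  apply: contra_eqN s => /eqP ->;
    rewrite size_norm /norm_size expr0n mul0r size_poly0 maxn0.
  have [->|nz] := eqVneq a 0; first by rewrite expr0n size_poly0.
  by rewrite expr2 size_mul_closed //; lia.
rewrite (negPf nzb) orFb in sb.
have sb1 : (size b <= 1)%N by lia.
have eb : b = (b`_0)%:P := size1_polyC sb1.
have ea : a = (a`_0)%:P + a`_1 *: 'X by apply: size2_linear; lia.
exists b`_0, a`_1, a`_0; split.
  by apply: contra_neq nzb => b0; rewrite eb b0.
by move=> x y xy; rewrite fab // [in LHS]ea [in LHS]eb hornerD !hornerC hornerZ
  hornerX; ring.
Qed.
End AffineFunctions.

(** * Regular functions are polynomials *)

Section RegularFunctions.
Variables (L : closedFieldType) (W : weierstrass L).

Lemma eq_polyfun f g : (forall x y, on_affine W x y -> f x y = g x y) ->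
  polyfun W g -> polyfun W f.
Proof. by move=> fg [a [b gab]]; exists a, b; exact: eq_represented gab. Qed.

Lemma polyfun_horner (p : {poly L}) : polyfun W (fun x _ => p.[x]).
Proof. by exists p, 0 => x y _; rewrite horner0 mul0r addr0. Qed.

Lemma polyfun_const c : polyfun W (fun _ _ => c).
Proof. by exists c%:P, 0; apply: represented_const. Qed.

Lemma polyfun_y : polyfun W (fun _ y => y).
Proof. exact: pole_polyfun (pole_y W). Qed.

Lemma polyfun_add f g : polyfun W f -> polyfun W g ->
  polyfun W (fun x y => f x y + g x y).
Proof.
move=> [a [b fab]] [a' [b' gab]].
by exists (a + a'), (b + b'); apply: represented_add.
Qed.

Lemma polyfun_mul f g : polyfun W f -> polyfun W g ->
  polyfun W (fun x y => f x y * g x y).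
Proof.
move=> [a [b fab]] [a' [b' gab]].
by eexists; eexists; apply: (represented_mul fab gab).
Qed.

Lemma polyfun_exp f k : polyfun W f -> polyfun W (fun x y => f x y ^+ k).
Proof.
move=> fP; elim: k => [|k IHk].
  by apply: eq_polyfun (polyfun_const 1) => x y _; rewrite expr0.
by apply: eq_polyfun (polyfun_mul fP IHk) => x y _; rewrite exprS.
Qed.

Lemma polyfun_sum (I : Type) (r : seq I) (F : I -> L -> L -> L) :
  (forall i, polyfun W (F i)) -> polyfun W (fun x y => \sum_(i <- r) F i x y).
Proof.
move=> FP; elim: r => [|i r IHr].
  by apply: eq_polyfun (polyfun_const 0) => x y _; rewrite big_nil.
by apply: eq_polyfun (polyfun_add (FP i) IHr) => x y _; rewrite big_cons.
Qed.

Lemma polyfun_meval (q : {mpoly L[3]}) :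
  polyfun W (fun x y => q.@[hcoord (Some (x, y))]).
Proof.
pose F (m : 'X_{1..3}) x y := q@_m * (x ^+ m (inord 0) * y ^+ m (inord 1)) : L.
apply: (@eq_polyfun _ (fun x y => \sum_(m <- msupp q) F m x y)) => [x y _|].
  rewrite mevalE; apply: eq_bigr => m _; rewrite /F; congr (_ * _).
  rewrite !big_ord_recl big_ord0 /= !(tnth_nth 0) /= expr1n !mulr1.
  by congr (_ ^+ m _ * _ ^+ m _); apply/val_inj; rewrite /= inordK.
apply: polyfun_sum => m; apply: polyfun_mul; first exact: polyfun_const.
apply: polyfun_mul (polyfun_exp _ polyfun_y).
by apply: eq_polyfun (polyfun_horner 'X^(m (inord 0))) => x y _;
  rewrite hornerXn.
Qed.

(** The denominators of f are an ideal of the coordinate ring. *)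
Definition denominator (f h : L -> L -> L) :=
  polyfun W h /\ polyfun W (fun x y => h x y * f x y).

Lemma denominator_add f h h' : denominator f h -> denominator f h' ->
  denominator f (fun x y => h x y + h' x y).
Proof.
move=> [hP hfP] [hP' hfP']; split; first exact: polyfun_add.
by apply: eq_polyfun (polyfun_add hfP hfP') => x y _; rewrite mulrDl.
Qed.

Lemma denominator_mul f h h' : denominator f h -> polyfun W h' ->
  denominator f (fun x y => h' x y * h x y).
Proof.
move=> [hP hfP] hP'; split; first exact: polyfun_mul.
by apply: eq_polyfun (polyfun_mul hP' hfP) => x y _; rewrite mulrA.
Qed.

Lemma eq_denominator f h h' : (forall x y, on_affine W x y -> h x y = h' x y) ->
  denominator f h' -> denominator f h.
Proof.
move=> hh' [hP hfP]; split; first exact: eq_polyfun hP.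
by apply: eq_polyfun hfP => x y xy; rewrite hh'.
Qed.

(** The norm of a denominator is a denominator that depends on x alone. If h is
    a denominator that vanishes at neither point above x0, its norm does not
    vanish at x0; such an h is one of two given denominators or their sum. So
    the polynomials in x among the denominators have no common root, and
    Euclidean division brings them down to a nonzero constant. *)
Lemma regular_polyfun f :
  (forall x0 y0, on_affine W x0 y0 ->
    exists2 h, denominator f h & h x0 y0 != 0) ->
  polyfun W f.
Proof.
move=> f_reg; pose den (p : {poly L}) := denominator f (fun x _ => p.[x]).
have den_at x0 : exists2 p, den p & p.[x0] != 0.
  have [y0 xy0] := exists_affine W x0.
  have [h1 h1d h1nz] := f_reg _ _ xy0.
  have [h2 h2d h2nz] := f_reg _ _ (on_affine_opp xy0).
  have [h hd /andP[hnz hnz']] : exists2 h, denominator f h &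
      (h x0 y0 != 0) && (h x0 (opp_y W x0 y0) != 0).
    have [e1|ne1] := eqVneq (h1 x0 (opp_y W x0 y0)) 0; last by exists h1 => //;
      rewrite h1nz.
    have [e2|ne2] := eqVneq (h2 x0 y0) 0; last by exists h2 => //; rewrite ne2.
    exists (fun x y => h1 x y + h2 x y); first exact: denominator_add.
    by rewrite e1 e2 add0r addr0 h1nz.
  have [[a [b hab]] _] := hd; exists (poly_norm W a b); last first.
    by rewrite (horner_norm _ _ xy0) -!hab ?on_affine_opp // mulf_neq0.
  apply: (@eq_denominator _ _
    (fun x y => (a.[x] + b.[x] * opp_y W x y) * h x y)).
    by move=> x y xy; rewrite (horner_norm _ _ xy) -(hab x y) // mulrC.
  apply: denominator_mul hd _; exists (a - b * lin_part W), (- b) => x y _.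
  rewrite /opp_y; move: (lin_part W) => l.
  by rewrite !(hornerD, hornerN, hornerM); ring.
have [n] : exists n, exists2 p, den p & (p != 0) && (size p <= n)%N.
  have [p pd p0] := den_at 0; exists (size p), p => //; rewrite leqnn andbT.
  by apply: contraNneq p0 => ->; rewrite horner0.
elim: n => [|n IHn] [p pd /andP[nzp sp]].
  by move: sp; rewrite leqn0 size_poly_eq0 (negPf nzp).
have [/closed_rootP[x0 px0]|] := boolP (size p != 1%N); last first.
  rewrite negbK => /size_poly1P[c nzc pc]; rewrite /den pc in pd.
  apply: eq_polyfun (polyfun_mul (polyfun_const c^-1) (proj2 pd)) => x y _.
  by rewrite hornerC mulrA mulVf // mul1r.
(* q %% p is again a denominator; it is nonzero as q does not vanish at the root
   x0 of p. *)
have [q qd qx0] := den_at x0; apply: IHn; exists (q %% p).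
  apply: (@eq_denominator _ _ (fun x y => q.[x] + (- (q %/ p)).[x] * p.[x])).
    move=> x y _; rewrite {2}(divp_eq q p) !(hornerD, hornerN, hornerM); ring.
  apply: denominator_add qd _.
  exact: denominator_mul pd (polyfun_horner _).
apply/andP; split; last by rewrite -ltnS (leq_trans _ sp) // ltn_modp.
apply: contraNneq qx0 => r0; rewrite (divp_eq q p) r0 addr0 hornerM.
by rewrite (rootP px0) mulr0.
Qed.

Lemma pole0 f : pole W f 0 -> exists c, forall x y, on_affine W x y ->
  f x y = c.
Proof.
move=> [a [b [fab s]]]; have [sa sb] := sizes_of_norm s.
rewrite orbF in sb; have sa1 : (size a <= 1)%N by lia.
exists a`_0 => x y xy.
by rewrite fab // (eqP sb) horner0 mul0r addr0 (size1_polyC sa1) hornerC coefC.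
Qed.

(** In Horner form the leading term dominates strictly at each step. *)
Lemma pole_horner f p (q : {poly L}) : (0 < p)%N -> pole W f p -> q != 0 ->
  pole W (fun x y => q.[f x y]) (p * (size q).-1).
Proof.
move=> p0 fp; elim/poly_ind: q => [|q c IHq]; first by rewrite eqxx.
rewrite size_MXaddC; have [->|nzq] := eqVneq q 0.
  rewrite mul0r add0r polyC_eq0 => nzc; rewrite (negPf nzc) size_poly0 muln0.
  by apply: eq_pole (pole_const _ nzc) => x y _; rewrite hornerC.
move=> _; rewrite /=.
have -> : (p * size q = p * (size q).-1 + p)%N.
  by rewrite -mulnSr prednK // size_gt0_closed.
apply: (eq_pole (f := fun x y => q.[f x y] * f x y + c)) => [x y _|].
  by rewrite hornerMXaddC.
apply: pole_add (pole_mul (IHq nzq) fp) (pole_le_const _ c 0); lia.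
Qed.

End RegularFunctions.

(** * Pole orders force isomorphisms to be linear *)

(** The pair (f, g) stands for the affine coordinates of an isomorphism from W
    to W', and the pair (al, be) for those of its inverse. *)
Section LinearForm.
Variables (L : closedFieldType) (W W' : weierstrass L).
Variables (f g al be : L -> L -> L).
Hypotheses (fP : polyfun W f) (gP : polyfun W g).
Hypotheses (alP : polyfun W' al) (beP : polyfun W' be).
Hypothesis fg_on : forall x y, on_affine W x y -> on_affine W' (f x y) (g x y).
Hypothesis alK : forall x y, on_affine W x y -> al (f x y) (g x y) = x.
Hypothesis beK : forall x y, on_affine W x y -> be (f x y) (g x y) = y.

Let rel x y : on_affine W x y ->
  g x y * g x y + (wa1 W' * (f x y * g x y) + (wa3 W' * g x y)) =
  f x y * (f x y * f x y) +
    (wa2 W' * (f x y * f x y) + (wa4 W' * f x y + wa6 W')).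
Proof.
move/fg_on; rewrite /on_affine /= => /eqP E.
transitivity (f x y ^+ 3 + wa2 W' * f x y ^+ 2 + wa4 W' * f x y + wa6 W');
  last by ring.
by rewrite -E; ring.
Qed.

Let not_const_pair c d :
  ~ (forall x y, on_affine W x y -> f x y = c /\ g x y = d).
Proof.
move=> H; have [y0 xy0] := exists_affine W 0;
  have [y1 xy1] := exists_affine W 1.
have := alK xy0; have := alK xy1.
have [-> ->] := H _ _ xy0; have [-> ->] := H _ _ xy1 => -> /eqP.
by rewrite oner_eq0.
Qed.

Let pole_le_scale h c d : pole_le W h d -> pole_le W (fun x y => c * h x y) d.
Proof. by move/(pole_le_mul (pole_le_const W c 0)). Qed.

Let pole_gt0_g m : (0 < m)%N -> pole W g m -> forall c,
  ~ (forall x y, on_affine W x y -> f x y = c).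
Proof.
move=> m0 gm c fc.
pose e := c * (c * c) + (wa2 W' * (c * c) + (wa4 W' * c + wa6 W')).
have gle := poleW (leqnn m) gm.
apply: (@not_pole0 L W (fun x y => g x y * g x y +
  ((wa1 W' * c + wa3 W') * g x y + - e)) (m + m)).
  by move=> x y xy; have := rel xy; rewrite fc // /e => <-; ring.
apply: (pole_add (e := m)) => //; first by lia.
  exact: pole_mul.
apply: pole_le_add (pole_le_const _ _ _); exact: pole_le_scale.
Qed.

Let pole_f : exists2 p, (0 < p)%N & pole W f p.
Proof.
have no_const c : (forall x y, on_affine W x y -> f x y = c) -> False.
  move=> fc; case: (polyfun_pole gP) => [g0|[[|m] gm]].
  - by case: (@not_const_pair c 0) => x y xy; rewrite fc ?g0.
  - have [d gd] := pole0 gm.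
    by case: (@not_const_pair c d) => x y xy; rewrite fc ?gd.
  - exact: (pole_gt0_g (ltn0Sn m) gm fc).
case: (polyfun_pole fP) => [/no_const//|[[|p] fp]]; last by exists p.+1.
by have [c /no_const] := pole0 fp.
Qed.

(** In the equation of W', the monomials g^2 and f^3 must have poles of the same
    order, for otherwise the larger one would exceed all other terms. *)
Let poles : exists k, [/\ (0 < k)%N, pole W f k.*2 & pole W g (k + k.*2)].
Proof.
have [p p0 fp] := pole_f; have fle := poleW (leqnn p) fp.
have small m : pole_le W g m -> (m.*2 < p + p.*2)%N -> False.
  move=> gm lt_mp.
  apply: (@not_pole0 L W (fun x y => f x y * (f x y * f x y) +
    ((wa2 W' * (f x y * f x y) + (wa4 W' * f x y + wa6 W'))
     + (- 1) * (g x y * g x y + (wa1 W' * (f x y * g x y) + (wa3 W' * g x y)))))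
       (p + (p + p))).
    by move=> x y xy; rewrite rel //; ring.
  apply: (pole_add (e := (p + p.*2).-1)); first by lia.
    exact: pole_mul fp (pole_mul fp fp).
  apply: pole_le_add.
    apply: pole_le_add; first by apply: pole_le_scale;
      apply: pole_leW (pole_le_mul fle fle); lia.
    apply: pole_le_add (pole_le_const _ _ _).
    by apply: pole_le_scale; apply: pole_leW fle; lia.
  apply: pole_le_scale; apply: pole_le_add;
    first by apply: pole_leW (pole_le_mul gm gm); lia.
  apply: pole_le_add; apply: pole_le_scale.
    by apply: pole_leW (pole_le_mul fle gm); lia.
  by apply: pole_leW gm; lia.
case: (polyfun_pole gP) => [g0|[m gm]].
  case: (small 0%N); last by lia.
  exists 0, 0; split; last by
    rewrite size_norm /norm_size expr0n mul0r size_poly0.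
  by move=> x y xy; rewrite g0 // !horner0 mul0r addr0.
have gle := poleW (leqnn m) gm.
have [lt_mp|gt_mp|eq_mp] := ltngtP m.*2 (p + p.*2).
- by case: (small m).
- case: (@not_pole0 L W (fun x y => g x y * g x y +
    ((wa1 W' * (f x y * g x y) + (wa3 W' * g x y)) + (- 1) *
      (f x y * (f x y * f x y) +
        (wa2 W' * (f x y * f x y) + (wa4 W' * f x y + wa6 W'))))) (m + m)).
    by move=> x y xy; rewrite -rel //; ring.
  apply: (pole_add (e := (m + m).-1)); first by lia.
    exact: pole_mul.
  apply: pole_le_add.
    apply: pole_le_add; apply: pole_le_scale.
      by apply: pole_leW (pole_le_mul fle gle); lia.
    by apply: pole_leW gle; lia.
  apply: pole_le_scale; apply: pole_le_add.
    by apply: pole_leW (pole_le_mul fle (pole_le_mul fle fle)); lia.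
  apply: pole_le_add; first by apply: pole_le_scale;
    apply: pole_leW (pole_le_mul fle fle); lia.
  apply: pole_le_add (pole_le_const _ _ _).
  by apply: pole_le_scale; apply: pole_leW fle; lia.
exists (m - p)%N; split; first by lia.
  by have -> : (m - p).*2 = p by lia.
by have -> : (m - p + (m - p).*2 = m)%N by lia.
Qed.

(** The poles of a(f) and b(f) g have orders that are multiples of k, the first
    an even multiple and the second an odd multiple. So they do not cancel. *)
Let pole_image k h d : (0 < k)%N -> pole W f k.*2 -> pole W g (k + k.*2) ->
  polyfun W' h -> pole W (fun x y => h (f x y) (g x y)) d -> (k %| d)%N.
Proof.
move=> k0 fk gk [a [b hab]] hd.
have k20 : (0 < k.*2)%N by lia.
have {}hd : pole W (fun x y => a.[f x y] + b.[f x y] * g x y) d.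
  by apply: eq_pole hd => x y /fg_on /hab.
have [b0|nzb] := eqVneq b 0.
  have {}hd : pole W (fun x y => a.[f x y]) d.
    by apply: eq_pole hd => x y _; rewrite b0 horner0 mul0r addr0.
  have [a0|nza] := eqVneq a 0.
    by case: (not_pole0 _ hd) => x y _; rewrite a0 horner0.
  by rewrite (pole_uniq hd (pole_horner k20 fk nza)) -muln2 -mulnA dvdn_mulr.
have bg := pole_mul (pole_horner k20 fk nzb) gk.
have [a0|nza] := eqVneq a 0.
  have {}hd : pole W (fun x y => b.[f x y] * g x y) d.
    by apply: eq_pole hd => x y _; rewrite a0 horner0 add0r.
  by rewrite (pole_uniq hd bg) -!muln2 -mulnA !dvdn_add ?dvdn_mulr.
have af := pole_horner k20 fk nza.
set i := (_ * _)%N in af; set j := (_ * _ + _)%N in bg.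
have [di dj] : (k %| i /\ k %| j)%N.
  by rewrite /i /j -!muln2 -!mulnA !dvdn_add ?dvdn_mulr.
have [lt_ij|lt_ji|eq_ij] := ltngtP i j.
- rewrite (pole_uniq hd (_ : pole W _ j)) //.
  apply: (eq_pole (f := fun x y => b.[f x y] * g x y + a.[f x y])) => [x y _|].
    by rewrite addrC.
  exact: pole_add lt_ij bg (poleW (leqnn _) af).
- by rewrite (pole_uniq hd (_ : pole W _ i)) //;
  exact: pole_add lt_ji af (poleW (leqnn _) bg).
move/(congr1 (fun z => odd (z %/ k))): eq_ij; rewrite /i /j.
rewrite (_ : (k.*2 * _ = ((size a).-1).*2 * k)%N); last by lia.
rewrite (_ : (k.*2 * _ + _ = (((size b).-1).*2 + 3) * k)%N); last by lia.
by rewrite !mulnK // oddD !odd_double.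
Qed.

(** The functions x and y on W are polynomials in f and g, so that k divides
    both 2 and 3. *)
Lemma linear_form : exists a r c s t, [/\ a != 0, c != 0,
  forall x y, on_affine W x y -> f x y = a * x + r
  & forall x y, on_affine W x y -> g x y = c * y + s * x + t].
Proof.
have [k [k0 fk gk]] := poles.
have d2 : (k %| 2)%N.
  by apply: (pole_image k0 fk gk alP); apply: eq_pole (pole_x W) => x y /alK.
have d3 : (k %| 3)%N.
  by apply: (pole_image k0 fk gk beP); apply: eq_pole (pole_y W) => x y /beK.
have k1 : k = 1%N by have := dvdn_gcd k 2 3; rewrite d2 d3 dvdn1 => /eqP.
rewrite k1 in fk gk.
have [a [r [nza fE]]] := pole2 fk; have [c [s [t [nzc gE]]]] := pole3 gk.
by exists a, r, c, s, t.
Qed.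

End LinearForm.

(** * Changes of coordinates and isomorphisms *)

Record change (R : Type) := Change { ca : R; cr : R; cc : R; cs : R; ct : R }.

Definition map_change (R S : Type) (f : R -> S) (p : change R) : change S :=
  Change (f (ca p)) (f (cr p)) (f (cc p)) (f (cs p)) (f (ct p)).

Local Notation i0 := (@Ordinal 3 0 isT).
Local Notation i1 := (@Ordinal 3 1 isT).
Local Notation i2 := (@Ordinal 3 2 isT).

Lemma ord3_ind (P : 'I_3 -> Prop) : P i0 -> P i1 -> P i2 -> forall i, P i.
Proof.
move=> P0 P1 P2 [[|[|[|//]]] lt_i].
- by rewrite (_ : Ordinal lt_i = i0) //; apply: val_inj.
- by rewrite (_ : Ordinal lt_i = i1) //; apply: val_inj.
- by rewrite (_ : Ordinal lt_i = i2) //; apply: val_inj.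
Qed.

Section ChangeOfCoordinates.
Variable F : fieldType.
Implicit Types p q : change F.

Definition change_map p (P : option (F * F)) : option (F * F) :=
  omap (fun xy => (ca p * xy.1 + cr p, cc p * xy.2 + cs p * xy.1 + ct p)) P.

Definition invertible p := (ca p != 0) && (cc p != 0).

Definition change_comp p q :=
  Change (ca p * ca q) (ca p * cr q + cr p) (cc p * cc q)
         (cc p * cs q + cs p * ca q) (cc p * ct q + cs p * cr q + ct p).

Definition change_inv p :=
  Change (ca p)^-1 (- cr p / ca p) (cc p)^-1 (- cs p / (ca p * cc p))
         ((cs p * cr p / ca p - ct p) / cc p).

Lemma change_map_comp p q P :
  change_map (change_comp p q) P = change_map p (change_map q P).
Proof. by case: P => [[x y]|] //=; congr (Some (_, _)); ring. Qed.

Lemma invertible_comp p q : invertible p -> invertible q ->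
  invertible (change_comp p q).
Proof. by move=> /andP[? ?] /andP[? ?]; rewrite /invertible /= !mulf_neq0. Qed.

Lemma invertible_inv p : invertible p -> invertible (change_inv p).
Proof. by move=> /andP[? ?]; rewrite /invertible /= !invr_neq0. Qed.

Lemma change_mapK p : invertible p ->
  cancel (change_map p) (change_map (change_inv p)).
Proof.
move=> /andP[nza nzc] [[x y]|] //=; congr (Some (_, _)); field;
  rewrite ?nza ?nzc //.
Qed.

Lemma change_map_invK p : invertible p ->
  cancel (change_map (change_inv p)) (change_map p).
Proof.
move=> /andP[nza nzc] [[x y]|] //=; congr (Some (_, _)); field;
  rewrite ?nza ?nzc //.
Qed.

End ChangeOfCoordinates.

Lemma map_change_inv (F F' : fieldType) (j : {rmorphism F -> F'}) p :
  map_change j (change_inv p) = change_inv (map_change j p).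
Proof.
by rewrite /change_inv /map_change /= !(rmorphM, fmorphV, rmorphN, rmorphB).
Qed.

Section ChangeOfCurve.
Variables (L : closedFieldType) (W W' : weierstrass L) (p : change L).
Local Notation a := (ca p). Local Notation r := (cr p).
Local Notation c := (cc p).
Local Notation s := (cs p). Local Notation t := (ct p).

Hypothesis pW : forall P, on_curve W P -> on_curve W' (change_map p P).

(** Composing the equation of W' with p, subtracting c^2 times the equation of W
    and collecting terms gives a polynomial in x plus a multiple of y by a
    polynomial in x, which vanishes on W. The equations say that each of its
    coefficients is zero. *)
Lemma change_equations :
  [/\ [/\ c * wa1 W' * a + 2 * c * s - c ^+ 2 * wa1 W = 0
        & c * wa1 W' * r + 2 * c * t + c * wa3 W' - c ^+ 2 * wa3 W = 0],
      c ^+ 2 - a ^+ 3 = 0,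
      s ^+ 2 + c ^+ 2 * wa2 W + wa1 W' * a * s - 3 * a ^+ 2 * r - wa2 W' *
        a ^+ 2 = 0,
      2 * s * t + c ^+ 2 * wa4 W + wa1 W' * (a * t + r * s) + wa3 W' * s
        - 3 * a * r ^+ 2 - 2 * wa2 W' * a * r - wa4 W' * a = 0
    & t ^+ 2 + c ^+ 2 * wa6 W + wa1 W' * r * t + wa3 W' * t
        - r ^+ 3 - wa2 W' * r ^+ 2 - wa4 W' * r - wa6 W' = 0].
Proof.
set m1 := (X in X = 0); set m0 := (X in [/\ _ & X = 0]).
set k3 := (X in [/\ _, X = 0, _, _ & _]);
  set k2 := (X in [/\ _, _, X = 0, _ & _]).
set k1 := (X in [/\ _, _, _, X = 0 & _]);
  set k0 := (X in [/\ _, _, _, _ & X = 0]).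
have rep : represented W (Poly [:: k0; k1; k2; k3]) (Poly [:: m0; m1])
  (fun _ _ => 0).
  move=> x y xy; have /= /eqP xy' := pW xy; have /= /eqP {}xy := xy.
  rewrite !horner_cons hornerC.
  transitivity ((c * y + s * x + t) ^+ 2 + wa1 W' * (a * x + r) *
    (c * y + s * x + t)
    + wa3 W' * (c * y + s * x + t) -
      ((a * x + r) ^+ 3 + wa2 W' * (a * x + r) ^+ 2 + wa4 W' * (a * x + r) +
      wa6 W')
    - c ^+ 2 * (y ^+ 2 + wa1 W * x * y + wa3 W * y -
      (x ^+ 3 + wa2 W * x ^+ 2 + wa4 W * x + wa6 W))).
    by rewrite xy' xy; ring.
  by rewrite /m0 /m1 /k0 /k1 /k2 /k3; ring.
have rep0 : represented W 0 0 (fun _ _ => 0).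
  by move=> x y _; rewrite horner0 mul0r addr0.
have [ek em] := represented_inj rep rep0.
have k i : [:: k0; k1; k2; k3]`_i = 0 by rewrite -coef_Poly ek coef0.
have m i : [:: m0; m1]`_i = 0 by rewrite -coef_Poly em coef0.
split; [split|..].
- exact: (m 1%N).
- exact: (m 0%N).
- exact: (k 3%N).
- exact: (k 2%N).
- exact: (k 1%N).
- exact: (k 0%N).
Qed.

(** By the equations above, composing the equation of W' with p gives c^2 times
    the equation of W, on the whole plane. Hence p also reflects the curve. *)
Lemma change_on_curve P : c != 0 -> on_curve W' (change_map p P) = on_curve W P.
Proof.
move=> nzc; case: P => [[x y]|] //=; rewrite -subr_eq0 -[RHS]subr_eq0.
have [[e1 e2] e3 e4 e5 e6] := change_equations.
rewrite -[RHS](mulrI_eq0 _ (mulfI (expf_neq0 2 nzc))); congr (_ == 0).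
apply/subr0_eq.
match type of e1 with ?e1 = 0 => match type of e2 with ?e2 = 0 =>
match type of e3 with ?e3 = 0 => match type of e4 with ?e4 = 0 =>
match type of e5 with ?e5 = 0 => match type of e6 with ?e6 = 0 =>
transitivity ((e1 * x + e2) * y + e3 * x ^+ 3 + e4 * x ^+ 2 + e5 * x + e6) end
  end end end end end.
  by ring.
by rewrite e1 e2 e3 e4 e5 e6; ring.
Qed.

End ChangeOfCurve.

Section Isomorphisms.
Variables (K : fieldType) (L : closedFieldType) (iota : {rmorphism K -> L}).

Implicit Types E : weierstrass K.

(** A function of two variables, as in the sections above; off the curve its
    value is the default point O. *)
Definition affine_point E x y : point iota E :=
  insubd (infinity iota E) (Some (x, y)).

Lemma val_affine_point E x y :
  on_affine (map_weierstrass iota E) x y ->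
    val (affine_point E x y) = Some (x, y).
Proof. by move=> xy; rewrite /affine_point val_insubd ifT. Qed.

Definition xcoord (E : weierstrass K) (P : point iota E) : L :=
  if val P is Some (x, _) then x else 0.
Definition ycoord (E : weierstrass K) (P : point iota E) : L :=
  if val P is Some (_, y) then y else 0.

Lemma val_coord E (P : point iota E) : P != infinity iota E ->
  val P = Some (xcoord P, ycoord P).
Proof.
rewrite /xcoord /ycoord -val_eqE /=.
by case: (val P) => [[x y]|].
Qed.

Definition change_of E E' (phi : point iota E -> point iota E') p :=
  forall P, val (phi P) = change_map p (val P).

Lemma change_of_curve E E' (phi : point iota E -> point iota E') p P :
  change_of phi p -> on_curve (map_weierstrass iota E) P ->
  on_curve (map_weierstrass iota E') (change_map p P).
Proof. by move=> pP onP; have := valP (phi (exist _ P onP)); rewrite pP. Qed.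

Lemma change_of_eq E E' (phi psi : point iota E -> point iota E') p :
  change_of phi p -> (change_of psi p <-> phi =1 psi).
Proof.
move=> phip; split=> [psip P|e P]; last by rewrite -e.
by apply: val_inj; rewrite phip psip.
Qed.

Lemma change_of_inj E E' (phi : point iota E -> point iota E') p q :
  change_of phi p -> change_of phi q -> p = q.
Proof.
move=> phip phiq; pose W := map_weierstrass iota E.
have pq x y : on_affine W x y ->
  change_map p (Some (x, y)) = change_map q (Some (x, y)).
  by move=> xy; rewrite -(val_affine_point xy) -phip -phiq.
pose X (p : change L) := Poly [:: cr p; ca p];
  pose Y (p : change L) := Poly [:: ct p; cs p].
have XP p' : represented W (X p') 0 (fun x _ => ca p' * x + cr p').
  by move=> x y xy; rewrite horner_Poly /= horner0; ring.
have YP p' : represented W (Y p') (cc p')%:P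
  (fun x y => cc p' * y + cs p' * x + ct p').
  by move=> x y xy; rewrite horner_Poly /= hornerC; ring.
have Xq : represented W (X q) 0 (fun x _ => ca p * x + cr p).
  by apply: eq_represented (XP q) => x y /pq[].
have Yq : represented W (Y q) (cc q)%:P (fun x y => cc p * y + cs p * x + ct p).
  by apply: eq_represented (YP q) => x y /pq[].
have [eX _] := represented_inj (XP p) Xq;
  have [eY /polyC_inj eC] := represented_inj (YP p) Yq.
have Xi i : [:: cr p; ca p]`_i = [:: cr q; ca q]`_i by have :=
  congr1 (fun u : {poly L} => u`_i) eX; rewrite !coef_Poly.
have Yi i : [:: ct p; cs p]`_i = [:: ct q; cs q]`_i by have :=
  congr1 (fun u : {poly L} => u`_i) eY; rewrite !coef_Poly.
move: (Xi 0%N) (Xi 1%N) (Yi 0%N) (Yi 1%N) eC.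
by case: (p) => ? ? ? ? ?; case: (q) => ? ? ? ? ? /= -> -> -> -> ->.
Qed.

Section OverF.
Variables (F : fieldType) (j : {rmorphism F -> L}).

Lemma polyfun_heval E (G : 'I_3 -> {mpoly F[3]}) i :
  polyfun (map_weierstrass iota E) (fun x y => heval j G (Some (x, y)) i).
Proof. exact: polyfun_meval. Qed.

(** If (G0, G1, G2) represents phi around a point, then G2 is a denominator
    there for both coordinates G0 / G2 and G1 / G2 of phi, and it does not
    vanish because phi takes no affine point to O. *)
Lemma morphism_polyfun E E' (phi : point iota E -> point iota E') :
  morphism_over j phi -> (forall P, P != infinity iota E ->
    phi P != infinity iota E') ->
  polyfun (map_weierstrass iota E)
    (fun x y => xcoord (phi (affine_point E x y))) /\
  polyfun (map_weierstrass iota E)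
    (fun x y => ycoord (phi (affine_point E x y))).
Proof.
move=> phiM phi_aff.
have aff_nz x y : on_affine (map_weierstrass iota E) x y ->
  affine_point E x y != infinity iota E.
  by move=> xy; rewrite -val_eqE val_affine_point.
suff main (x0 y0 : L) : on_affine (map_weierstrass iota E) x0 y0 ->
    exists2 h, polyfun (map_weierstrass iota E) h & h x0 y0 != 0 /\
      polyfun (map_weierstrass iota E)
        (fun x y => h x y * xcoord (phi (affine_point E x y))) /\
      polyfun (map_weierstrass iota E)
        (fun x y => h x y * ycoord (phi (affine_point E x y))).
  by split; apply: regular_polyfun => x0 y0 /main[h hP [h0 [hX hY]]]; exists h.
move=> xy0; have [d [G [_ [i Gi] Gphi]]] := phiM (affine_point E x0 y0).
have Gval x y (xy : on_affine (map_weierstrass iota E) x y) : let Q :=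
  phi (affine_point E x y) in
    let g i := heval j G (Some (x, y)) i in
    g i0 = g i2 * xcoord Q /\ g i1 = g i2 * ycoord Q.
  move=> Q g; have [/existsP|] := boolP [exists i, g i != 0]; last first.
    rewrite negb_exists => /forallP g0.
    have {}g0 i' : g i' = 0 by apply/eqP; have := g0 i'; rewrite negbK.
    by rewrite !g0 !mul0r.
  rewrite /g -(val_affine_point xy) => /Gphi[e eP].
  rewrite !eP (val_coord (phi_aff _ (aff_nz _ _ xy))) /= !(tnth_nth 0) /=.
  by rewrite -/Q mulr1.
exists (fun x y => heval j G (Some (x, y)) i2); first exact: polyfun_heval.
split.
  have [g0 g1] := Gval _ _ xy0; rewrite (val_affine_point xy0) in Gi.
  apply: contraNneq Gi => g2; rewrite g2 !mul0r in g0 g1.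
  by apply/eqP; move: i; apply: ord3_ind.
by split;
  [apply: eq_polyfun (polyfun_heval E G i0) | apply:
  eq_polyfun (polyfun_heval E G i1)] => x y /Gval[].
Qed.

Lemma iso_change E E' (phi : point iota E -> point iota E') :
  isomorphism_over j phi -> exists2 p, invertible p & change_of phi p.
Proof.
move=> [phiM phiO [psi [psiM phiK psiK]]].
have psiO : psi (infinity iota E') = infinity iota E by rewrite -phiO phiK.
have phi_aff P : P != infinity iota E -> phi P != infinity iota E'.
  by rewrite -phiO (inj_eq (can_inj phiK)).
have psi_aff P : P != infinity iota E' -> psi P != infinity iota E.
  by rewrite -psiO (inj_eq (can_inj psiK)).
have [fP gP] := morphism_polyfun phiM phi_aff;
  have [aP bP] := morphism_polyfun psiM psi_aff.
have aff x y (xy : on_affine (map_weierstrass iota E) x y) : 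
    val (phi (affine_point E x y)) =
      Some (xcoord (phi (affine_point E x y)),
      ycoord (phi (affine_point E x y))).
  by apply/val_coord/phi_aff; rewrite -val_eqE val_affine_point.
have fg_on x y (xy : on_affine (map_weierstrass iota E) x y) :
    on_affine (map_weierstrass iota E') (xcoord (phi (affine_point E x y)))
      (ycoord (phi (affine_point E x y))).
  by rewrite /on_affine -aff //; apply: valP.
have back x y (xy : on_affine (map_weierstrass iota E) x y) :
    psi (affine_point E' (xcoord (phi (affine_point E x y)))
      (ycoord (phi (affine_point E x y)))) = affine_point E x y.
  rewrite -[RHS]phiK; congr psi; apply: val_inj.
  by rewrite val_affine_point ?fg_on // -aff.
have [||a [r [c [s [t [nza nzc fE gE]]]]]] := linear_form fP gP aP bP fg_on.
- by move=> x y xy; rewrite back // /xcoord val_affine_point.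
- by move=> x y xy; rewrite back // /ycoord val_affine_point.
exists (Change a r c s t); first by rewrite /invertible nza.
move=> P; case E0: (val P) => [[x y]|] /=; last first.
  have -> : P = infinity iota E by apply: val_inj.
  by rewrite phiO.
have xy : on_affine (map_weierstrass iota E) x y by rewrite /on_affine -E0;
  apply: valP.
have -> : P = affine_point E x y by apply: val_inj; rewrite val_affine_point.
by rewrite aff // fE // gE.
Qed.

Lemma change_morphism E E' (phi : point iota E -> point iota E') (p :
  change F) :
  invertible p -> change_of phi (map_change j p) -> morphism_over j phi.
Proof.
move=> /andP[nza nzc] phip P.
pose G (i : 'I_3) : {mpoly F[3]} :=
  if val i is 0%N then ca p *: 'X_i0 + cr p *: 'X_i2 else
  if val i is 1%N then cc p *: 'X_i1 + cs p *: 'X_i0 + ct p *: 'X_i2 else 'X_i2.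
pose q := map_change j p.
have GE Q i : heval j G Q i =
  if val i is 0%N then ca q * hcoord Q i0 + cr q * hcoord Q i2 else
  if val i is 1%N then cc q * hcoord Q i1 + cs q * hcoord Q i0 + ct q *
    hcoord Q i2 else hcoord Q i2.
  rewrite /heval /G; case: i => [[|[|i]]] ? /=; 
    by rewrite ?(raddfD, map_mpolyZ, map_mpolyX, mevalD, mevalZ, mevalXU) /=
      ?map_mpolyZ ?map_mpolyX ?mevalZ ?mevalXU.
have Gpos Q : exists i, heval j G Q i != 0.
  case: Q => [[x y]|]; first by exists i2;
    rewrite GE /= (tnth_nth 0) /= oner_eq0.
  exists i1; rewrite GE /= !(tnth_nth 0) /= mulr1 !mulr0 !addr0.
  by rewrite fmorph_eq0.
exists 1%N, G; split=> [i||Q _]; last 1 first.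
- exists (if val Q is Some _ then 1 else cc q) => i; rewrite phip.
  case: (val Q) => [[x y]|] /=; rewrite GE /= !(tnth_nth 0) /=;
    by case: i => [[|[|[|//]]]] ? /=; ring.
- have dX k : ('X_k : {mpoly F[3]}) \is 1.-homog by rewrite dhomogX; apply/eqP;
  apply: mdeg1.
  by rewrite /G; case: i => [[|[|i]]] ? /=; rewrite ?rpredD ?dhomogZ.
- exact: Gpos.
Qed.

Lemma change_iso E E' (phi : point iota E -> point iota E') (p : change F) :
  invertible p -> change_of phi (map_change j p) -> isomorphism_over j phi.
Proof.
move=> p_inv phip; split; first exact: change_morphism phip.
  by apply: val_inj; rewrite phip.
have q_inv : invertible (map_change j p) by rewrite /invertible /= !fmorph_eq0.
have on_inv (P : point iota E') :
    on_curve (map_weierstrass iota E)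
      (change_map (change_inv (map_change j p)) (val P)).
  have /andP[_ nzc] := q_inv.
  rewrite -(change_on_curve (fun P => change_of_curve phip) _ nzc).
  by rewrite change_map_invK //; apply: valP.
pose psi P : point iota E :=
  exist (fun Q => is_true (on_curve (map_weierstrass iota E) Q)) _ (on_inv P);
  exists psi; split.
- by apply: (@change_morphism _ _ _ (change_inv p));
  rewrite ?invertible_inv // => P; rewrite map_change_inv.
- by move=> P; apply: val_inj; rewrite /= phip change_mapK.
- by move=> P; apply: val_inj; rewrite phip /= change_map_invK.
Qed.

End OverF.
End Isomorphisms.

(** * Galois descent *)

Section GaloisAction.
Variables (K : fieldType) (L : closedFieldType) (iota : {rmorphism K -> L}).
Implicit Types (E : weierstrass K) (s : galois_elt iota).

Lemma gal_pointK s E : cancel (gal_point s (E := E)) (gal_point_inv s (E := E)).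
Proof.
by move=> P; apply: val_inj; case: P => -[[x y]|] //= _; rewrite !gal_funK.
Qed.

Lemma gal_conj_comp s E1 E2 E3 (phi : point iota E2 -> point iota E3)
    (psi : point iota E1 -> point iota E2) :
  gal_conj s (phi \o psi) =1 gal_conj s phi \o gal_conj s psi.
Proof. by move=> P; rewrite /gal_conj /= gal_pointK. Qed.

Lemma gal_conj_id s E : gal_conj s (@id (point iota E)) =1 id.
Proof. by move=> P; rewrite /gal_conj gal_point_invK. Qed.

Lemma eq_gal_conj s E E' (phi psi : point iota E -> point iota E') :
  phi =1 psi -> gal_conj s phi =1 gal_conj s psi.
Proof. by move=> e P; rewrite /gal_conj e. Qed.

Lemma gal_conj_cancel s E E' (phi : point iota E -> point iota E') psi :
  cancel phi psi -> cancel (gal_conj s phi) (gal_conj s psi).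
Proof. by move=> phiK P; rewrite /gal_conj gal_pointK phiK gal_point_invK. Qed.

Lemma change_of_gal s E E' (phi : point iota E -> point iota E') p :
  change_of phi p -> change_of (gal_conj s phi) (map_change s p).
Proof.
move=> phip P; rewrite -{2}(gal_point_invK s P) /gal_conj /= phip /=.
by case: (val P) => [[x y]|] //=; rewrite !(rmorphD, rmorphM) !gal_invK.
Qed.

Definition galois_one : galois_elt iota :=
  @GaloisElt K L iota idfun id (fun _ => erefl) (fun _ => erefl)
    (fun _ => erefl).

Definition galois_comp s s' : galois_elt iota :=
  @GaloisElt K L iota (gal_fun s \o gal_fun s')
    (Defs.gal_inv s' \o Defs.gal_inv s)
    (can_comp (gal_funK s) (gal_funK s')) (can_comp (gal_invK s') (gal_invK s))
    (fun a => etrans (congr1 s (gal_fix s' a)) (gal_fix s a)).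

Definition galois_pow s n := iter n (galois_comp s) galois_one.

Lemma gal_conj_one E E' (phi : point iota E -> point iota E') :
  gal_conj galois_one phi =1 phi.
Proof.
have idP E0 (P : point iota E0) : gal_point galois_one P = P.
  by apply: val_inj => /=; case: (val P) => [[x y]|].
have idVP E0 (P : point iota E0) : gal_point_inv galois_one P = P.
  by apply: val_inj => /=; case: (val P) => [[x y]|].
by move=> P; rewrite /gal_conj idP idVP.
Qed.

Lemma gal_conj_powS s n E E' (phi : point iota E -> point iota E') :
  gal_conj (galois_pow s n.+1) phi =1 gal_conj s
    (gal_conj (galois_pow s n) phi).
Proof.
move=> P; apply: val_inj => /=; rewrite /gal_conj.
set Q := gal_point_inv _ P; set Q' := gal_point_inv _ (gal_point_inv s P).
have -> : Q = Q' by apply: val_inj => /=; case: (val P) => [[x y]|].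
by rewrite /=; case: (val _) => [[x y]|].
Qed.

Lemma hcoord_inj (c c' : L) P P' :
  c != 0 -> (forall i, c * hcoord P i = c' * hcoord P' i) -> P = P'.
Proof.
move=> nzc e.
have := e i0; have := e i1; have := e i2.
case: P {e} => [[x y]|]; case: P' => [[x' y']|] //=;
  rewrite !(tnth_nth 0) /= ?mulr1 ?mulr0.
- by move=> <- /(mulfI nzc) -> /(mulfI nzc) ->.
- by move=> /eqP; rewrite (negPf nzc).
- by move=> <- /eqP; rewrite mul0r (negPf nzc).
Qed.

Section Descent.
Variables (F : fieldType) (j : {rmorphism F -> L}) (s : galois_elt iota).

(** Conjugation by s does not change polynomials whose coefficients s fixes. *)
Lemma heval_fixed (G : 'I_3 -> {mpoly F[3]}) P i : (forall a, s (j a) = j a) ->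
  heval j G (map_coord s P) i = s (heval j G P i).
Proof.
move=> sj; rewrite /heval -meval_map
  (@meval_eq _ _ _ (s \o hcoord P) _ (fun i => hcoord_gal s P i)).
by congr meval; apply/mpolyP => m; rewrite !mcoeff_map_mpoly /= sj.
Qed.

(** If G represents phi around Q, then s sends the values of G at Q to its
    values at s(Q), hence s sends phi(Q) to phi(s(Q)). *)
Lemma morphism_over_fixed E E' (phi : point iota E -> point iota E') :
  (forall a, s (j a) = j a) -> morphism_over j phi -> gal_conj s phi =1 phi.
Proof.
move=> sj phiM P; rewrite -{2}(gal_point_invK s P) /gal_conj.
set Q := gal_point_inv s P; have [d [G [_ [i Gi] Gphi]]] := phiM Q.
have [c cP] := Gphi Q (ex_intro _ i Gi).
have Gi' : heval j G (val (gal_point s Q)) i != 0 by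
  rewrite heval_fixed // fmorph_eq0.
have [c' cP'] := Gphi _ (ex_intro _ i Gi').
apply: val_inj; apply: (@hcoord_inj (s c) c'); last first.
  by move=> k; rewrite hcoord_gal -rmorphM -cP -cP' heval_fixed.
by rewrite fmorph_eq0; apply: contraNneq Gi => c0; rewrite cP c0 mul0r.
Qed.
End Descent.

(** This is [geom_isomorphism] over a base field that need not be finite. *)
Definition geom_iso E E' (phi : point iota E -> point iota E') :=
  isomorphism_over (idfun : {rmorphism L -> L}) phi.

Lemma map_change_id (p : change L) : map_change idfun p = p.
Proof. by case: p. Qed.

Lemma geom_isoP E E' (phi : point iota E -> point iota E') :
  geom_iso phi <-> exists2 p, invertible p & change_of phi p.
Proof.
split=> [|[p p_inv phip]]; first exact: iso_change.
by apply: (change_iso p_inv); rewrite map_change_id.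
Qed.

Lemma geom_iso_id E : geom_iso (@id (point iota E)).
Proof.
apply/geom_isoP; exists (Change 1 0 1 0 0);
  first by rewrite /invertible !oner_eq0.
move=> P; case: (val P) => [[x y]|] //=.
by rewrite !(mul1r, mul0r, addr0).
Qed.

Lemma geom_iso_comp E1 E2 E3 (phi : point iota E2 -> point iota E3)
    (psi : point iota E1 -> point iota E2) :
  geom_iso phi -> geom_iso psi -> geom_iso (phi \o psi).
Proof.
move=> /geom_isoP[p p_inv phip] /geom_isoP[q q_inv psiq]; apply/geom_isoP.
exists (change_comp p q); first exact: invertible_comp.
by move=> P /=; rewrite phip psiq change_map_comp.
Qed.

Lemma geom_iso_inv E E' (phi : point iota E -> point iota E') : geom_iso phi ->
  exists psi, [/\ geom_iso psi, cancel phi psi & cancel psi phi].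
Proof.
move=> [phiM phiO [psi [psiM phiK psiK]]]; exists psi; split=> //; split=> //.
  by rewrite -phiO phiK.
by exists phi.
Qed.

Lemma geom_iso_can E E' (phi : point iota E -> point iota E') psi :
  geom_iso phi -> cancel phi psi -> cancel psi phi -> geom_iso psi.
Proof.
move=> /geom_iso_inv[psi' [/geom_isoP[p p_inv psip] phiK' psiK']] phiK psiK.
apply/geom_isoP; exists p => // P; rewrite -psip; congr (val _).
by rewrite -{2}(psiK P) phiK'.
Qed.

Lemma eq_geom_iso E E' (phi psi : point iota E -> point iota E') :
  phi =1 psi -> geom_iso phi -> geom_iso psi.
Proof.
move=> e /geom_isoP[p p_inv phip]; apply/geom_isoP; exists p => //.
exact/(change_of_eq psi phip).
Qed.

Lemma geom_iso_conj s E E' (phi : point iota E -> point iota E') :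
  geom_iso phi -> geom_iso (gal_conj s phi).
Proof.
move=> /geom_isoP[p /andP[nza nzc] phip]; apply/geom_isoP.
exists (map_change s p); last exact: change_of_gal.
by rewrite /invertible /= !fmorph_eq0 nza.
Qed.

(** By uniqueness, the change of coordinates that gives phi is fixed by s as
    soon as phi is, and then its coefficients are in the image of j. *)
Lemma iso_over_fixedP (F : fieldType) (j : {rmorphism F -> L}) s E E'
    (phi : point iota E -> point iota E') :
  (forall x, s x = x <-> exists y, x = j y) ->
  isomorphism_over j phi <-> geom_iso phi /\ gal_conj s phi =1 phi.
Proof.
move=> fix_j; split=> [phi_iso|[/geom_isoP[p /andP[nza nzc] phip] phi_fix]].
  split; first by apply/geom_isoP; apply: iso_change phi_iso.
  case: phi_iso => phiM _ _; apply: morphism_over_fixed phiM => a.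
  by apply/fix_j; exists a.
have sp : map_change s p = p.
  apply: (@change_of_inj _ _ _ _ _ phi _ _ _ phip).
  by apply/(change_of_eq _ (change_of_gal s phip)).
have [q pq] : exists q, p = map_change j q.
  case: p sp {nza nzc phip} => a r c t u [] /fix_j[a' ->] /fix_j[r' ->]
    /fix_j[c' ->] /fix_j[t' ->] /fix_j[u' ->].
  by exists (Change a' r' c' t' u').
apply: (@change_iso _ _ _ _ _ _ _ _ q); last by rewrite -pq.
by move: nza nzc; rewrite pq /invertible /= !fmorph_eq0 => -> ->.
Qed.

End GaloisAction.

Section FiniteFields.
Variables (K : finFieldType) (L : closedFieldType) (iota : {rmorphism K -> L}).

Lemma frobenius_powE n x : galois_pow (frobenius iota) n x = x ^+ (#|K| ^ n).
Proof.
elim: n => [|n IHn]; first by rewrite expn0 expr1.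
by rewrite expnSr exprM -IHn.
Qed.

(** The polynomial X^#|F| - X splits over F with the elements of F as roots. *)
Lemma fixed_by_power (F : finFieldType) (j : {rmorphism F -> L}) x :
  x ^+ #|F| = x <-> exists y, x = j y.
Proof.
split=> [xF|[y ->]]; last by rewrite -rmorphXn /= expf_card.
have := congr1 (fun p => (map_poly j p).[x]) (finField_genPoly F).
rewrite rmorphB /= map_polyXn map_polyX !hornerE xF subrr rmorph_prod
  horner_prod.
move/esym/eqP; rewrite prodf_seq_eq0 => /hasP[y _ /=].
by rewrite rmorphB /= map_polyX map_polyC !hornerE subr_eq0 => /eqP ->;
  exists y.
Qed.

Lemma rational_isomorphicP E E' :
  rational_isomorphic iota E E' <->
  exists2 phi : point iota E -> point iota E',
    geom_iso phi & gal_conj (frobenius iota) phi =1 phi.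
Proof.
have fixK x : frobenius iota x = x <->
  exists y, x = iota y by exact: fixed_by_power.
split=> [[phi /(iso_over_fixedP _ fixK)[]]|[phi phi_iso phi_fix]];
  first by exists phi.
by exists phi; apply/(iso_over_fixedP _ fixK).
Qed.
End FiniteFields.

(** * Subfields of given degree *)

Section SubfieldOfDegree.
Variables (K : finFieldType) (L : closedFieldType) (iota : {rmorphism K -> L}).
Local Notation q := #|K|.

Lemma closed_prim_root n : n%:R != 0 :> L -> exists z : L, n.-primitive_root z.
Proof.
move=> nz_n; have n_gt0 : (0 < n)%N by rewrite lt0n;
  apply: contraNneq nz_n => ->.
have [rs Ers] := closed_field_poly_normal ('X^n - 1 : {poly L}).
have mon : lead_coef ('X^n - 1 : {poly L}) = 1 by apply/monicP/monicXnsubC.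
rewrite mon scale1r in Ers.
have szrs : size rs = n.
  by apply/eqP; rewrite -eqSS -(size_prod_XsubC rs id) -Ers size_XnsubC.
have uniq_rs : uniq rs by
  rewrite -separable_prod_XsubC -Ers cyclotomic.separable_Xn_sub_1.
have /hasP[z _ zP] : has n.-primitive_root rs.
  apply: has_prim_root => //; last by rewrite szrs.
  by apply/allP => x xrs; rewrite -[_ x]/(root _ x) Ers root_prod_XsubC.
by exists z.
Qed.

Lemma pred_card_pow_neq0 d : (0 < d)%N -> (q ^ d).-1%:R != 0 :> L.
Proof.
move=> d0; have [p p_pr pK] := finPcharP K.
have q0 : q%:R = 0 :> L.
  have [k qk] : exists k, q = (p ^ k)%N by eexists; apply: card_pprimeChar.
  have := finNzRing_gt1 K; rewrite qk natrX -(rmorph_nat iota) (pcharf0 pK)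
    rmorph0 expr0n.
  by case: k {qk} => // k.
have e : (q ^ d).-1%:R + 1 = 0 :> L.
  rewrite -[1]/(1%:R) -natrD addn1 prednK;
    last by rewrite expn_gt0 (ltnW (finNzRing_gt1 K)).
  by rewrite natrX q0 expr0n; case: d d0.
by apply/eqP => e0; move/eqP: e; rewrite e0 add0r oner_eq0.
Qed.

Section Generator.
Variables (d : nat) (z : L).
Hypotheses (d_gt0 : (0 < d)%N) (zP : (q ^ d).-1.-primitive_root z).

Let conjugates := [seq z ^+ (q ^ i) | i <- seq.iota 0 d].

Let uniq_conjugates : uniq conjugates.
Proof.
have q1 : (1 < q)%N := finNzRing_gt1 K.
rewrite map_inj_in_uniq ?iota_uniq // => i k.
rewrite !mem_iota !add0n /= => lt_id lt_kd /eqP.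
have [d1|d1] := leqP d 1; first by lia.
have small m : (m < d)%N -> (q ^ m < (q ^ d).-1)%N.
  move=> lt_md; apply: leq_ltn_trans (_ : q ^ d.-1 < _)%N.
    by rewrite leq_exp2l //; lia.
  by rewrite -{2}(ltn_predK d1) expnS; have := ltn_expl d.-1 q1; nia.
by rewrite (eq_prim_root_expr zP) !modn_small ?small // eqn_exp2l // => /eqP.
Qed.

(** The d conjugates of z under the powers of Frobenius are distinct roots. *)
Let size_vanishing (p : {poly K}) : root (map_poly iota p) z -> p != 0 ->
  (d < size p)%N.
Proof.
move=> pz nzp; rewrite -(size_map_poly iota).
have -> : d = size conjugates by rewrite size_map size_iota.
apply: max_poly_roots uniq_conjugates; first by rewrite map_poly_eq0.
apply/allP => _ /mapP[i _ ->]; elim: i => [|i IHi];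
  first by rewrite expn0 expr1.
rewrite expnSr exprM; set x := z ^+ _ in IHi *.
rewrite -[_ ^+ q]/(frob_fun iota x) /root.
have -> : map_poly iota p = map_poly (frob_fun iota) (map_poly iota p).
  by rewrite -map_poly_comp; apply: eq_map_poly => a /=; rewrite frob_fix.
by rewrite horner_map fmorph_eq0.
Qed.

Let frobenius_invariant_poly (P : {poly L}) : map_poly (frob_fun iota) P = P ->
  exists p : {poly K}, map_poly iota p = P.
Proof.
move=> fixP.
have [c cP] : exists c : 'I_(size P) -> K, forall i :
  'I_(size P), P`_i = iota (c i).
  suff cP (i : 'I_(size P)) :
    exists y, P`_i = iota y by apply: fin_all_exists cP.
  apply/fixed_by_power.
  by have := congr1 (fun u : {poly L} => u`_i) fixP; rewrite coef_map.
exists (\poly_(i < size P) oapp c 0 (insub i)); apply/polyP => i.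
rewrite coef_map coef_poly; case: ltnP => [lt_i|le_i];
  last by rewrite [LHS]rmorph0 nth_default.
by rewrite insubT /= -cP.
Qed.

(** The product of the X - z^(q^i) for i < d is fixed by Frobenius, since
    z^(q^d) = z. By the previous bound it has the least possible degree. *)
Lemma min_poly_over : exists p : {poly K},
  [/\ size p = d.+1, root (map_poly iota p) z & irreducible_poly p].
Proof.
pose P := \prod_(x <- conjugates) ('X - x%:P).
have [|p pP] := @frobenius_invariant_poly P.
  rewrite /P rmorph_prod /= !big_map.
  under eq_bigr => i _ do rewrite rmorphB /= map_polyX map_polyC /=
    /frob_fun -exprM -expnSr.
  have zq : z ^+ (q ^ d) = z.
    have q_gt0 : (0 < q ^ d)%N by rewrite expn_gt0 (ltnW (finNzRing_gt1 K)).
    by rewrite -(prednK q_gt0) exprS (prim_expr_order zP) mulr1.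
  rewrite -(prednK d_gt0) -[seq.iota 0 d.-1.+1 in RHS]/(0%N :: seq.iota 1 d.-1)
    big_cons expn0 expr1.
  rewrite (_ : seq.iota 0 d.-1.+1 = rcons (seq.iota 0 d.-1) d.-1); last first.
    by rewrite -addn1 iotaD cats1.
  rewrite big_rcons /= prednK // zq mulrC; congr (_ * _).
  by rewrite -[1%N]addn0 iotaDl big_map; apply: eq_bigr.
have nzp : p != 0.
  by rewrite -(map_poly_eq0 iota) pP monic_neq0 // monic_prod_XsubC.
have szp : size p = d.+1.
  by rewrite -(size_map_poly iota) pP size_prod_XsubC size_map size_iota.
have pz : root (map_poly iota p) z.
  rewrite pP root_prod_XsubC; apply/mapP; exists 0%N;
    last by rewrite expn0 expr1.
  by rewrite mem_iota.
exists p; split => //; apply/(subfx_irreducibleP pz nzp) => r rz nzr.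
by rewrite szp size_vanishing.
Qed.

End Generator.

Lemma subfield_of_degree d : (0 < d)%N ->
  exists (F : fieldExtType K) (j : {rmorphism F -> L}),
    \dim {:F} = d /\ forall a : K, j a%:A = iota a.
Proof.
move=> d0; have [z zP] := closed_prim_root (pred_card_pow_neq0 d0).
have [p [szp pz irr_p]] := min_poly_over d0 zP.
have nzp : p != 0 := irredp_neq0 irr_p.
exists (SubFieldExtType pz irr_p),
  (@subfx_inj K L iota z p : {rmorphism _ -> _}).
split; first by rewrite dimvf /dim /= szp.
exact: (subfx_inj_base pz nzp).
Qed.

Lemma fixed_by_subfield (F : fieldExtType K) (j : {rmorphism F -> L}) x :
  x ^+ (q ^ \dim {:F}) = x <-> exists y, x = j y.
Proof.
have -> : (q ^ \dim {:F})%N = #|finvect_type F|.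
  by rewrite -(card_vspace (fullv : {vspace finvect_type F})) card_vspacef.
exact: (@fixed_by_power L (finvect_type F) (j :
  {rmorphism finvect_type F -> L})).
Qed.

(** The images in L of all extensions of degree d are the fixed field of the
    d-th power of Frobenius. *)
Lemma isomorphic_in_degreeP E E' d : isomorphic_in_degree iota E E' d <->
  (0 < d)%N /\ exists2 phi : point iota E -> point iota E',
    geom_iso phi & gal_conj (galois_pow (frobenius iota) d) phi =1 phi.
Proof.
have fixF (F : fieldExtType K) (j : {rmorphism F -> L}) x :
    galois_pow (frobenius iota) (\dim {:F}) x = x <-> exists y, x = j y.
  by rewrite frobenius_powE; exact: fixed_by_subfield.
split=>
  [[F [j [<- jK [phi /(iso_over_fixedP _ (fixF F j))[phi_iso phi_fix]]]]]|].
  by split; [exact: adim_gt0 | exists phi].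
case=> d0 [phi phi_iso phi_fix];
  have [F [j [dimF jK]]] := subfield_of_degree d0.
exists F, j; split=> //; exists phi.
by apply/(iso_over_fixedP _ (fixF F j)); rewrite dimF.
Qed.
End SubfieldOfDegree.

(** * Twists and Frobenius classes *)

Section Twisting.
Variables (K : finFieldType) (L : closedFieldType) (iota : {rmorphism K -> L}).
Variable E : weierstrass K.
Local Notation Fr := (frobenius iota).
Local Notation "phi ^F" := (gal_conj Fr phi) (at level 2, format "phi ^F").
Local Notation fn := (point iota E -> point iota E).
Local Notation aut := (@automorphism K L iota E).

(* As Fr is an involution on automorphisms, sigma = Fr alpha turns the element
   sigma^-1 tau (Fr sigma) of the class of tau into (Fr alpha)^-1 tau alpha,
   which is the cocycle of psi o alpha when tau is that of psi. *)
Hypothesis frob2_aut : forall alpha : fn, aut alpha -> (alpha^F)^F =1 alpha.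

(** The condition defining the Frobenius class of tau, multiplied by sigma, so
    that no inverse is needed. *)
Definition frob_conj (tau phi : fn) :=
  exists2 sigma : fn, aut sigma & sigma \o phi =1 tau \o sigma^F.

Lemma frob_classP tau phi : frob_class tau phi <-> frob_conj tau phi.
Proof.
split=> [[s [s' [s_aut sK s'K e]]]|[s s_aut e]].
  by exists s => // P /=; rewrite e /= s'K.
have [s' [_ sK s'K]] := geom_iso_inv s_aut; exists s, s'; split=> // P /=.
by rewrite -[RHS]/(s' ((tau \o s^F) P)) -e /= sK.
Qed.

Lemma frob_conj_refl tau : frob_conj tau tau.
Proof.
exists id; first exact: geom_iso_id.
by move=> P /=; rewrite gal_conj_id.
Qed.

Lemma frob_conj_sym tau phi : frob_conj tau phi -> frob_conj phi tau.
Proof.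
move=> [s s_aut e]; have [s' [s'_aut sK s'K]] := geom_iso_inv s_aut.
exists s' => // P /=; have := e ((s'^F) P) => /=.
by rewrite (gal_conj_cancel Fr s'K) => /(congr1 s') <-; rewrite sK.
Qed.

Lemma frob_conj_trans tau phi chi :
  frob_conj tau phi -> frob_conj phi chi -> frob_conj tau chi.
Proof.
move=> [s s_aut e] [s' s'_aut e']; exists (s \o s'); first exact: geom_iso_comp.
move=> P; rewrite /= (gal_conj_comp Fr s s' P).
by rewrite -[chi P]/(id _) -[s' (chi P)]/((s' \o chi) P) e' /=
  -[s _]/((s \o phi) _) e.
Qed.

Lemma frob_conj_ext tau tau' phi phi' : tau =1 tau' -> phi =1 phi' ->
  frob_conj tau phi -> frob_conj tau' phi'.
Proof.
by move=> et ep [s s_aut e]; exists s => // P; rewrite /= -et -ep; apply: e.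
Qed.

Lemma same_classP tau phi :
  same_class (@frob_class K L iota E) tau phi <-> frob_conj tau phi.
Proof.
split=> [same|tp chi].
  by apply/frob_conj_sym/frob_classP/same/frob_classP/frob_conj_refl.
split=> /frob_classP h; apply/frob_classP; last exact: frob_conj_trans h.
by apply: frob_conj_trans h; apply: frob_conj_sym.
Qed.

(** The automorphism tau is (Fr psi)^-1 o psi, the value at Fr of the cocycle of
    the twist. *)
Definition splits Etw (psi : point iota E -> point iota Etw) (tau : fn) :=
  geom_iso psi /\ psi =1 psi^F \o tau.

Lemma splits_ext Etw (psi : point iota E -> point iota Etw) tau tau' :
  tau =1 tau' -> splits psi tau -> splits psi tau'.
Proof. by move=> e [psi_iso psiE]; split=> // P; rewrite psiE /= e. Qed.

(** If (Fr psi)^-1 o psi is only Frobenius conjugate to tau, by sigma, then psi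
    o Fr(sigma^-1) has tau itself as its cocycle. *)
Lemma correspondsP tau Etw :
  corresponds tau Etw <-> is_twist iota E Etw /\
    exists psi : point iota E -> point iota Etw, splits psi tau.
Proof.
split=> [[tw [psi [rho [psi_iso rhoK rho'K cl]]]]|[tw [psi [psi_iso psiE]]]].
  have [s [s' [s_aut sK s'K e]]] := cl.
  split=> //; have s'_aut : aut s' by apply: geom_iso_can sK s'K.
  exists (psi \o s'^F); split; first by apply: geom_iso_comp => //;
    apply: geom_iso_conj.
  move=> P /=; rewrite (gal_conj_comp Fr psi s'^F (tau P)) /= frob2_aut //.
  have := e (s'^F P) => /=; rewrite (gal_conj_cancel Fr s'K) => <-.
  by rewrite rho'K.
split=> //; have [rho [_ rhoK rho'K]] :=
  geom_iso_inv (geom_iso_conj Fr psi_iso).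
exists psi, rho; split=> //; apply/frob_classP;
  apply: frob_conj_ext (frob_conj_refl tau) => // P.
by rewrite /= psiE /= rhoK.
Qed.

Lemma exists_cocycle Etw (psi : point iota E -> point iota Etw) :
  geom_iso psi -> exists2 tau, aut tau & splits psi tau.
Proof.
move=> psi_iso; have [rho [rho_iso rhoK rho'K]] :=
  geom_iso_inv (geom_iso_conj Fr psi_iso).
exists (rho \o psi); first exact: geom_iso_comp.
by split=> // P /=; rewrite rho'K.
Qed.

Lemma splits_id : splits (@id (point iota E)) id.
Proof. by split=> [|P]; [apply: geom_iso_id | rewrite /= gal_conj_id]. Qed.

(** An isomorphism chi from E1 to E2 is fixed by Frobenius if and only if alpha
    = psi2^-1 o chi o psi1 satisfies tau2 o alpha = (Fr alpha) o tau1. This is a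
    Frobenius conjugation by sigma = Fr alpha. *)
Lemma splits_isomorphic E1 E2 (psi1 : point iota E -> point iota E1)
    (psi2 : point iota E -> point iota E2) tau1 tau2 :
  splits psi1 tau1 -> splits psi2 tau2 ->
  rational_isomorphic iota E1 E2 <-> frob_conj tau2 tau1.
Proof.
move=> [psi1_iso e1] [psi2_iso e2];
  split=> [/rational_isomorphicP[chi chi_iso chi_fix]|[s s_aut e]].
  have [rho [rho_iso rhoK rho'K]] := geom_iso_inv psi2_iso.
  pose al := rho \o chi \o psi1.
  have al_aut : aut al by apply: geom_iso_comp => //; apply: geom_iso_comp.
  exists al^F; first exact: geom_iso_conj.
  move=> P /=; rewrite frob2_aut //.
  apply: (can_inj (gal_conj_cancel Fr rhoK)).
  rewrite -[RHS]/((psi2^F \o tau2) (al P)) -e2 /al /= rho'K.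
  rewrite (gal_conj_comp Fr (rho \o chi) psi1) /= (gal_conj_comp Fr rho chi) /=.
  rewrite (gal_conj_cancel Fr rho'K) chi_fix; congr chi.
  by rewrite e1.
have [rho [rho_iso rhoK rho'K]] := geom_iso_inv psi1_iso.
apply/rational_isomorphicP; exists (psi2 \o s^F \o rho).
  by apply: geom_iso_comp => //; apply: geom_iso_comp => //;
    apply: geom_iso_conj.
move=> Q; rewrite (gal_conj_comp Fr (psi2 \o s^F) rho) /=
  (gal_conj_comp Fr psi2 s^F) /= frob2_aut //.
set P := rho Q; have -> : rho^F Q = tau1 P.
  by rewrite -(rho'K Q) -/P e1 /= (gal_conj_cancel Fr rhoK).
rewrite -[s (tau1 P)]/((s \o tau1) P) e /=.
by rewrite -[RHS]/(psi2 _) e2.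
Qed.

(** The value at Fr^e of the cocycle whose value at Fr is tau. *)
Fixpoint frob_norm (tau : fn) (e : nat) : fn :=
  if e is e'.+1 then (frob_norm tau e')^F \o tau else id.

Lemma splits_norm Etw (psi : point iota E -> point iota Etw) tau e :
  splits psi tau -> psi =1 gal_conj (galois_pow Fr e) psi \o frob_norm tau e.
Proof.
move=> [_ psiE]; elim: e => [|e IHe] P; first by rewrite /= gal_conj_one.
rewrite [LHS]psiE /= gal_conj_powS (eq_gal_conj Fr IHe).
by rewrite (gal_conj_comp Fr (gal_conj (galois_pow Fr e) psi)
  (frob_norm tau e)).
Qed.

(** Every isomorphism from E to Etw is psi o alpha for an automorphism alpha,
    and (Fr^e psi) o N_e = psi where N_e is [frob_norm tau e]. *)
Lemma splits_degree Etw (psi : point iota E -> point iota Etw) tau e :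
  splits psi tau -> isomorphic_in_degree iota E Etw e <->
  (0 < e)%N /\ exists2 alpha : fn, aut alpha &
     gal_conj (galois_pow Fr e) alpha =1 frob_norm tau e \o alpha.
Proof.
move=> psi_spl; have psiN := splits_norm e psi_spl; have [psi_iso _] := psi_spl.
have [rho [rho_iso rhoK rho'K]] := geom_iso_inv psi_iso.
split=>
  [/isomorphic_in_degreeP[e0 [phi phi_iso phi_fix]]|[e0 [al al_aut al_e]]].
  split=> //; exists (rho \o phi); first exact: geom_iso_comp.
  move=> P; apply: (can_inj (gal_conj_cancel (galois_pow Fr e) rhoK)).
  rewrite -[RHS]/((gal_conj (galois_pow Fr e) psi \o frob_norm tau e)
    ((rho \o phi) P)) -psiN /= rho'K.
  by rewrite (gal_conj_comp (galois_pow Fr e) rho phi) /=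
    (gal_conj_cancel _ rho'K) phi_fix.
apply/isomorphic_in_degreeP; split=> //; exists (psi \o al);
  first exact: geom_iso_comp.
move=> P; rewrite (gal_conj_comp (galois_pow Fr e) psi al) /= al_e.
by rewrite [RHS]psiN.
Qed.

Hypothesis lang : forall tau : fn, aut tau -> exists (Etw : weierstrass K) 
  (psi : point iota E -> point iota Etw), elliptic Etw /\ splits psi tau.

Lemma exists_twist tau : aut tau -> exists Etw, corresponds tau Etw.
Proof.
move=> /lang[Etw [psi [Etw_ell psi_spl]]]; exists Etw; apply/correspondsP.
by split; [split=> //; exists psi; case: psi_spl | exists psi].
Qed.

Lemma twist_degree_norm tau d : aut tau -> (0 < d)%N ->
  (exists2 alpha : fn, aut alpha &
     gal_conj (galois_pow Fr d) alpha =1 frob_norm tau d \o alpha) ->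
  (forall e (alpha : fn), (0 < e < d)%N -> aut alpha ->
     ~ gal_conj (galois_pow Fr e) alpha =1 frob_norm tau e \o alpha) ->
  twist_degree tau d.
Proof.
move=> tau_aut d0 at_d below_d; split; first exact: exists_twist.
move=> Etw /correspondsP[_ [psi psi_spl]]; split;
  first exact/(splits_degree _ psi_spl).
move=> e /(splits_degree _ psi_spl)[e0 [al al_aut al_e]].
rewrite leqNgt; apply/negP => lt_ed.
by case: (below_d e al _ al_aut al_e); rewrite e0.
Qed.

Lemma splits_conj Etw (psi : point iota E -> point iota Etw) tau tau' :
  splits psi tau -> frob_conj tau tau' ->
  exists psi' : point iota E -> point iota Etw, splits psi' tau'.
Proof.
move=> [psi_iso psiE] [s s_aut e]; exists (psi \o s^F).
split; first by apply: geom_iso_comp => //; apply: geom_iso_conj.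
move=> P; rewrite /= (gal_conj_comp Fr psi s^F) /= frob2_aut //.
by rewrite -[s _]/((s \o tau') P) e psiE.
Qed.

Section Representatives.
Variables (m : nat) (c : m.+1.-tuple fn).
Hypothesis c0 : tnth c ord0 =1 id.
Hypothesis c_reps : representatives aut (same_class (@frob_class K L iota E)) c.

Let c_inj i k : frob_conj (tnth c i) (tnth c k) -> i = k.
Proof.
have [c_aut c_uniq] := c_reps => ik.
have [l [_ l_uniq]] := c_uniq _ (c_aut i).
transitivity l; [symmetry|]; apply: l_uniq; apply/same_classP => //.
exact: frob_conj_refl.
Qed.

Lemma nontrivial_twistP Etw : nontrivial_twist iota E Etw <->
  exists2 i, i != ord0 & corresponds (tnth c i) Etw.
Proof.
have [c_aut c_uniq] := c_reps;
  split=> [[tw not_iso]|[i i0 /correspondsP[tw [psi psi_spl]]]].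
  have [_ [psi /exists_cocycle[tau tau_aut psi_spl]]] := tw.
  have [i [/same_classP tau_i _]] := c_uniq _ tau_aut.
  have [psi' psi'_spl] := splits_conj psi_spl tau_i.
  exists i; last by apply/correspondsP; split=> //; exists psi'.
  apply/eqP => i0; apply: not_iso; rewrite i0 in psi'_spl.
  apply/(splits_isomorphic splits_id (splits_ext c0 psi'_spl)).
  exact: frob_conj_refl.
split=> // /(splits_isomorphic splits_id psi_spl) ci_id.
move/eqP: i0; apply; apply: c_inj; apply: frob_conj_ext ci_id => //.
Qed.

Lemma twist_representatives : exists T : m.-tuple (weierstrass K),
  representatives (nontrivial_twist iota E) (rational_isomorphic iota) T.
Proof.
have [c_aut c_uniq] := c_reps.
have ex_T (i : 'I_m) : exists Etw, corresponds (tnth c (lift ord0 i)) Etw.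
  exact: exists_twist.
have [T TP] := fin_all_exists ex_T; exists (mktuple T).
split=> [i|Etw /nontrivial_twistP[i]].
  by rewrite tnth_mktuple; apply/nontrivial_twistP; exists (lift ord0 i).
case: (unliftP ord0 i) => [k ->|-> /eqP//] _ /correspondsP[_ [psi psi_spl]].
exists k; split=> [|k']; rewrite tnth_mktuple.
  have [_ [psi' psi'_spl]] := (correspondsP _ _).1 (TP k).
  by apply/(splits_isomorphic psi_spl psi'_spl); apply: frob_conj_refl.
have [_ [psi' psi'_spl]] := (correspondsP _ _).1 (TP k').
by move/(splits_isomorphic psi_spl psi'_spl)/c_inj/lift_inj.
Qed.

End Representatives.
End Twisting.

(** * Automorphisms of the curve y^2 + y = x^3 *)

(** The equations for a change of coordinates determine the coefficients of the
    target one after the other. *)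
Lemma change_target_uniq (L : closedFieldType) (W W1 W2 : weierstrass L)
    (p : change L) :
  invertible p ->
  (forall P, on_curve W P -> on_curve W1 (change_map p P)) ->
  (forall P, on_curve W P -> on_curve W2 (change_map p P)) -> W1 = W2.
Proof.
move=> /andP[nza nzc] /change_equations[[e1 e2] _ e4 e5 e6]
  /change_equations[[f1 f2] _ f4 f5 f6].
have [nza2 nzac] : ca p ^+ 2 != 0 /\
  cc p * ca p != 0 by rewrite expf_neq0 // mulf_neq0.
have g1 : wa1 W1 = wa1 W2.
  apply: (mulfI nzac); apply: subr0_eq; rewrite -[RHS](subrr 0) -{1}e1 -f1;
    ring.
have g3 : wa3 W1 = wa3 W2.
  apply: (mulfI nzc); apply: subr0_eq; rewrite -[RHS](subrr 0) -{1}e2 -f2 g1;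
    ring.
have g2 : wa2 W1 = wa2 W2.
  apply: (mulfI nza2); apply: subr0_eq; rewrite -[RHS](subrr 0) -{1}f4 -e4 g1;
    ring.
have g4 : wa4 W1 = wa4 W2.
  apply: (mulfI nza); apply: subr0_eq;
    rewrite -[RHS](subrr 0) -{1}f5 -e5 g1 g2 g3; ring.
have g6 : wa6 W1 = wa6 W2.
  by apply: subr0_eq; rewrite -[RHS](subrr 0) -{1}f6 -e6 g1 g2 g3 g4; ring.
by case: (W1) (W2) g1 g2 g3 g4 g6 => [? ? ? ? ?] [? ? ? ? ?] /= -> -> -> -> ->.
Qed.

Lemma on_curve_map (L : fieldType) (s : {rmorphism L -> L})
    (W : weierstrass L) P :
  on_curve (map_weierstrass s W) (map_coord s P) = on_curve W P.
Proof.
case: P => [[x y]|] //=; rewrite -[RHS](inj_eq (fmorph_inj s)).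
by rewrite !(rmorphD, rmorphM, rmorphXn).
Qed.

Lemma change_map_conj (L : fieldType) (s : {rmorphism L -> L})
    (p : change L) P :
  change_map (map_change s p) (map_coord s P) = map_coord s (change_map p P).
Proof. by case: P => [[x y]|] //=; rewrite !(rmorphD, rmorphM). Qed.

Section Characteristic2.
Variables (K : fieldType) (L : closedFieldType) (iota : {rmorphism K -> L}).
Hypothesis L2 : 2 \in [pchar L].
Local Notation E := (curve K).

(** An identity in characteristic 2 is an identity over the integers up to an
    explicit multiple z of 2. *)
Lemma eq_mod2 (x y z : L) : x = y + 2 * z -> x = y.
Proof. by rewrite (pcharf0 L2) mul0r addr0. Qed.

Lemma sqr_inj2 (x y : L) : x ^+ 2 = y ^+ 2 -> x = y.
Proof.
move=> e; suff /eqP : (x - y) ^+ 2 = 0 by rewrite expf_eq0 subr_eq0 => /eqP.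
by rewrite sqrrB e; apply: (@eq_mod2 _ _ (y ^+ 2 - x * y)); ring.
Qed.

Lemma map_curve : map_weierstrass iota (curve K) = curve L.
Proof. by rewrite /map_weierstrass /= !rmorph0 rmorph1. Qed.

Lemma Phi_cube (u r t : L) : Phi_valid u r t -> u ^+ 3 = 1.
Proof.
by move=> /and4P[nz_u /eqP u4 _ _]; apply: (mulfI nz_u);
  rewrite -exprS u4 mulr1.
Qed.

Definition Phi_change (u r t : L) := Change (u ^+ 2) r 1 (u ^+ 2 * r ^+ 2) t.

Lemma invertible_Phi u r t : Phi_valid u r t -> invertible (Phi_change u r t).
Proof. by case/andP=> nz_u _; rewrite /invertible /= expf_neq0 // oner_eq0. Qed.

Lemma change_of_Phi u r t : Phi_valid u r t ->
  change_of (Phi iota u r t) (Phi_change u r t).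
Proof.
move=> valid P; rewrite val_Phi //; case: (val P) => [[x y]|] //=.
by rewrite mul1r.
Qed.

(** The equations for a change of coordinates of the curve to itself give c = 1,
    a^3 = 1, s = a r^2 and r^4 = r; the square root of a is u = a^2. *)
Lemma automorphism_PhiP (f : point iota E -> point iota E) : geom_iso f <->
  exists u r t, Phi_valid u r t /\ f =1 Phi iota u r t.
Proof.
split=> [/geom_isoP[p /andP[nza nzc] fp]|[u [r [t [valid e]]]]]; last first.
  apply: eq_geom_iso (fsym e) _; apply/geom_isoP; exists (Phi_change u r t).
    exact: invertible_Phi.
  exact: change_of_Phi.
have [[_ e2] e3 e4 e5 e6] :=
  change_equations (fun P => change_of_curve fp (P := P)).
case: p nza nzc fp e2 e3 e4 e5 e6 => a r c s t /= nza nzc fp.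
rewrite !rmorph0 !rmorph1 => e2 e3 e4 e5 e6.
have c1 : c = 1.
  apply: (mulfI nzc); apply/esym; apply: (@eq_mod2 _ _ (- c * t)).
  by apply/subr0_eq; rewrite -e2; ring.
rewrite {}c1 {c nzc e2} in fp e3 e4 e5 e6 *.
have a3 : a ^+ 3 = 1 by apply/esym/subr0_eq; rewrite -e3; ring.
have s2 : s ^+ 2 = a ^+ 2 * r.
  by apply: (@eq_mod2 _ _ (a ^+ 2 * r)); apply/subr0_eq; rewrite -e4; ring.
have s1 : s = a * r ^+ 2.
  by apply: (@eq_mod2 _ _ (a * r ^+ 2 - s * t)); apply/subr0_eq; rewrite -e5;
    ring.
have r4 : r ^+ 4 = r.
  by apply: (mulfI (expf_neq0 2 nza)); rewrite -s2 s1; ring.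
have u2 : (a ^+ 2) ^+ 2 = a by rewrite -exprM exprS a3 mulr1.
have tr : t ^+ 2 + t + r ^+ 3 = 0.
  by apply: (@eq_mod2 _ _ (r ^+ 3)); rewrite add0r; apply/subr0_eq; rewrite -e6;
    ring.
have valid : Phi_valid (a ^+ 2) r t.
  rewrite /Phi_valid expf_neq0 // r4 tr !eqxx !andbT -exprM.
  have -> : a ^+ (2 * 4) = (a ^+ 3) ^+ 2 * a ^+ 2 by ring.
  by rewrite a3 expr1n mul1r eqxx.
exists (a ^+ 2), r, t; split=> //.
apply/(change_of_eq _ fp); have := change_of_Phi valid.
by rewrite /Phi_change u2 -s1.
Qed.

(** For t: squaring t^2 = t + r^3 gives t^4 = t + r^3 + r^6, and r^6 = r^3. *)
Lemma Phi_valid_pow4 (u r t : L) : Phi_valid u r t ->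
  [/\ u ^+ 4 = u, r ^+ 4 = r & t ^+ 4 = t].
Proof.
move=> /and4P[_ /eqP u4 /eqP r4 /eqP tr]; split=> //.
have t2 : t ^+ 2 = t + r ^+ 3.
  by apply: (@eq_mod2 _ _ (- t - r ^+ 3)); apply/subr0_eq; rewrite -[RHS]tr;
    ring.
apply: (@eq_mod2 _ _ (r ^+ 3 + t * r ^+ 3)).
rewrite -[4%N]/(2 * 2)%N exprM t2 sqrrD t2.
have -> : (r ^+ 3) ^+ 2 = r ^+ 3 by transitivity (r ^+ 4 * r ^+ 2);
  [ring | rewrite r4; ring].
by ring.
Qed.

Lemma aut_fixed (s : galois_elt iota) (f : point iota E -> point iota E) :
  (forall x, x ^+ 4 = x -> s x = x) -> geom_iso f -> gal_conj s f =1 f.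
Proof.
move=> s4 /automorphism_PhiP[u [r [t [valid e]]]].
have [/s4 su /s4 sr /s4 st] := Phi_valid_pow4 valid.
have fp : change_of f (Phi_change u r t).
  exact/(change_of_eq _ (change_of_Phi valid))/fsym.
apply/(change_of_eq _ (change_of_gal s fp)).
by rewrite /map_change /= !(rmorphM, rmorphXn, rmorph1) /= su sr st.
Qed.

End Characteristic2.

(** * Every automorphism comes from a twist *)

Section Lang.
Variables (K : finFieldType) (L : closedFieldType) (iota : {rmorphism K -> L}).
Hypothesis L2 : 2 \in [pchar L].
Local Notation E := (curve K).
Local Notation q := #|K|.

Lemma frob_linear_root (b d : L) : exists x, x ^+ q = b * x + d.
Proof.
have q1 : (1 < q)%N := finNzRing_gt1 K.
have [x xP] := @solve_monicpoly L q
  (fun i => if i == 0%N then d else if i == 1%N then b else 0) (ltnW q1).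
exists x; rewrite xP; case: (q) q1 => [|[|m]] // _.
rewrite !big_ord_recl /= expr0 expr1 mulr1 big1 ?addr0 1?addrC // => i _.
by rewrite mul0r.
Qed.

Lemma frob_kummer_root (b : L) : b != 0 -> exists2 a, a != 0 & a ^+ q = a * b.
Proof.
move=> nzb; have q1 : (1 < q)%N := finNzRing_gt1 K.
have q0 : (0 < q.-1)%N by lia.
have [a aP] := @solve_monicpoly L q.-1 (fun i => if i == 0%N then b else 0) q0.
have {}aP : a ^+ q.-1 = b.
  rewrite aP; case: (q.-1) q0 => // m _.
  by rewrite big_ord_recl /= expr0 mulr1 big1 ?addr0 // => i _; rewrite mul0r.
exists a; last by rewrite -aP -exprS prednK // ltnW.
by apply: contraNneq nzb => a0; rewrite -aP a0 expr0n; case: (q.-1) q0.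
Qed.

Lemma frobenius_invariant_curve (W : weierstrass L) :
  map_weierstrass (frob_fun iota) W = W ->
  exists E' : weierstrass K, map_weierstrass iota E' = W.
Proof.
have fixP x : frob_fun iota x = x ->
  exists y, x = iota y by move/fixed_by_power.
case: W => a1 a2 a3 a4 a6 [] /fixP[b1 ->] /fixP[b2 ->].
move=> /fixP[b3 ->] /fixP[b4 ->] /fixP[b6 ->].
by exists (Weierstrass b1 b2 b3 b4 b6).
Qed.

(** When a1 = 0, the discriminant is a3^4 up to a multiple of 2. *)
Lemma supersingular_elliptic (E' : weierstrass K) : wa1 E' = 0 -> wa3 E' != 0 ->
  elliptic E'.
Proof.
move=> a1 nza3; have K2 : 2 = 0 :> K.
  by apply: (fmorph_inj iota); rewrite rmorph_nat rmorph0 (pcharf0 L2).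
rewrite /elliptic (_ : discriminant E' = wa3 E' ^+ 4) ?expf_neq0 //.
case: E' a1 {nza3} => a1 a2 a3 a4 a6 /= ->.
transitivity (a3 ^+ 4 + 2 * (- 14 * a3 ^+ 4 - 108 * a3 ^+ 2 * a6 - 216 * a6 ^+ 2
  - 8 * a2 ^+ 2 * (4 * a2 * a6 + a2 * a3 ^+ 2 - a4 ^+ 2) - 32 * a4 ^+ 3
  + 36 * a2 * a4 * (a3 ^+ 2 + 4 * a6))); last by rewrite K2 mul0r addr0.
by rewrite /discriminant /wb2 /wb4 /wb6 /wb8 /=; ring.
Qed.

(** For tau = Phi_(u,rho,theta), the equation psi = (Fr psi) o tau on changes of
    coordinates is triangular in a, r, c, s, t, and each equation is solvable in
    an algebraically closed field. The image of the curve under the solution p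
    is then also its image under Fr p, so that it is invariant under Frobenius
    and has coefficients in K. *)
Lemma lang_curve (tau : point iota E -> point iota E) : geom_iso tau ->
  exists (Etw : weierstrass K) (psi : point iota E -> point iota Etw),
    elliptic Etw /\ splits psi tau.
Proof.
move=> /(automorphism_PhiP L2)[u [rho [th [valid e]]]].
have taup : change_of tau (Phi_change u rho th).
  exact/(change_of_eq _ (change_of_Phi L2 valid))/fsym.
have u3 := Phi_cube valid; have nzu : u != 0 by case/andP: valid.
have [a nza aq] := frob_kummer_root (expf_neq0 2 (invr_neq0 nzu)).
have [c c2] := quadratic_root 0 (a ^+ 3); rewrite mul0r addr0 in c2.
have nzc : c != 0 by apply: contraNneq (expf_neq0 3 nza) => c0;
  rewrite -c2 c0 expr0n.
(* The square c^2 = a^3 is fixed by Frobenius, because u^3 = 1. *)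
have cq : c ^+ q = c.
  apply: (sqr_inj2 L2); rewrite exprAC c2 exprAC aq exprMn.
  by rewrite -exprM -[(2 * 3)%N]/(3 * 2)%N exprM exprVn u3 invr1 expr1n mulr1.
have [r rq] := frob_linear_root 1 (- a ^+ q * rho).
have [s sq] := frob_linear_root (u^-1 ^+ 2) (- c * rho ^+ 2).
have [t tq] := frob_linear_root 1 (- c * th - s ^+ q * rho).
pose p := Change a r c s t; pose Fp := map_change (frobenius iota) p.
have p_inv : invertible p by rewrite /invertible /= nza.
have pE : p = change_comp Fp (Phi_change u rho th).
  rewrite /change_comp /= /frob_fun cq aq rq sq tq; congr Change.
  - by field.
  - by rewrite aq; ring.
  - by rewrite mulr1.
  - by rewrite mulrDl; field.
  - by rewrite sq; ring.
(* The coefficients of the target are given by change_equations. *)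
pose a2 := (s ^+ 2 - 3 * a ^+ 2 * r) / a ^+ 2.
pose a4 := (2 * s * t + c * s - 3 * a * r ^+ 2 - 2 * a2 * a * r) / a.
pose a6 := t ^+ 2 + c * t - r ^+ 3 - a2 * r ^+ 2 - a4 * r.
pose W := Weierstrass 0 a2 c a4 a6.
have pW P : on_curve (curve L) P -> on_curve W (change_map p P).
  case: P => [[x y]|] //= /eqP; rewrite !mul0r !addr0 mul1r => xy; apply/eqP.
  have y2 : y ^+ 2 = x ^+ 3 - y by rewrite -xy addrK.
  apply: (@eq_mod2 L L2 _ _ (c * (s * x + t) * y)).
  transitivity (c ^+ 2 * y ^+ 2 + c ^+ 2 * y + 2 * (c * (s * x + t) * y) +
    (s * x + t) ^+ 2 + c * (s * x + t)).
    by ring.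
  rewrite y2 c2 /a6 /a4 /a2; field.
  by rewrite nza.
have FpW P : on_curve (curve L) P ->
  on_curve (map_weierstrass (frob_fun iota) W) (change_map p P).
  rewrite -(map_curve iota) => onP; rewrite pE change_map_comp.
  have := change_of_curve taup onP; move: (change_map _ P) => Q {P onP} onQ.
  pose Q' := map_coord (frob_inv iota) Q.
  have -> : Q = map_coord (frob_fun iota) Q'.
    by rewrite /Q'; case: (Q) => [[x y]|] //=; rewrite !frob_invK.
  rewrite change_map_conj on_curve_map; apply: pW.
  by rewrite -(map_curve iota) (on_curve_gal_inv (frobenius iota)).
have [Etw EtwW] := frobenius_invariant_curve (change_target_uniq p_inv FpW pW).
have on_psi (P : point iota E) :
  on_curve (map_weierstrass iota Etw) (change_map p (val P)).
  by rewrite EtwW; apply: pW; rewrite -(map_curve iota); apply: valP.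
pose psi P : point iota Etw :=
  exist (fun Q => is_true (on_curve (map_weierstrass iota Etw) Q)) _ (on_psi P).
exists Etw, psi; split.
  have [e1 _ e3 _ _] := EtwW.
  apply: supersingular_elliptic.
    by apply: (fmorph_inj iota); rewrite e1 rmorph0.
  by rewrite -(fmorph_eq0 iota) e3.
have psip : change_of psi p by [].
split; first by apply/geom_isoP; exists p.
apply/(change_of_eq _ psip) => P.
rewrite -[LHS]/(val (gal_conj (frobenius iota) psi (tau P))).
by rewrite (change_of_gal (frobenius iota) psip) taup -change_map_comp -pE.
Qed.
End Lang.

(** * A finite model of the automorphism group *)

(** The pair (b0, b1) stands for b0 + b1 omega, where omega is a primitive third
    root of unity. *)
Definition F4 := (bool * bool)%type.
Definition f4_0 : F4 := (false, false).
Definition f4_1 : F4 := (true, false).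
Definition f4_w : F4 := (false, true).
Definition f4_w2 : F4 := (true, true).
Definition f4_add (x y : F4) : F4 := (x.1 (+) y.1, x.2 (+) y.2).
Definition f4_mul (x y : F4) : F4 :=
  ((x.1 && y.1) (+) (x.2 && y.2),
    (x.1 && y.2) (+) (x.2 && y.1) (+) (x.2 && y.2)).
Definition f4_sqr (x : F4) := f4_mul x x.
Definition f4_enum : seq F4 := [:: f4_0; f4_1; f4_w; f4_w2].

(** The triple (u, r, t) stands for the automorphism Phi_(u,r,t). *)
Definition A24 := (F4 * F4 * F4)%type.
Definition a24_one : A24 := (f4_1, f4_0, f4_0).

(** Composition of automorphisms; g is applied after h. *)
Definition a24_mul (g h : A24) : A24 :=
  let: (u, r, t) := g in let: (u', r', t') := h in
  let u2 := f4_sqr u in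
  (f4_mul u u', f4_add (f4_mul u2 r') r,
   f4_add (f4_add t t') (f4_mul (f4_mul u2 (f4_sqr r)) r')).
Definition a24_frob (g : A24) : A24 :=
  let: (u, r, t) := g in (f4_sqr u, f4_sqr r, f4_sqr t).
Definition a24_valid (g : A24) : bool :=
  let: (u, r, t) := g in
  (u != f4_0) && (f4_add (f4_add (f4_sqr t) t) (f4_mul r (f4_sqr r)) == f4_0).
Definition a24_triples : seq A24 :=
  [seq (ur, t) | ur <- [seq (u, r) | u <- f4_enum, r <- f4_enum], t <- f4_enum].
Definition a24_enum : seq A24 := [seq g <- a24_triples | a24_valid g].

Lemma mem_a24_enum g : (g \in a24_enum) = a24_valid g.
Proof.
rewrite mem_filter andb_idr // => _.
by case: g => [[[[] []] [[] []]] [[] []]].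
Qed.

Lemma a24_valid_mul g h : a24_valid g -> a24_valid h -> a24_valid (a24_mul g h).
Proof.
have : all (fun g => all (fun h => a24_valid (a24_mul g h)) a24_enum) a24_enum
  by vm_compute.
by rewrite -(mem_a24_enum g) -(mem_a24_enum h) => /allP H /H /allP; apply.
Qed.

Lemma a24_valid_frob g : a24_valid g -> a24_valid (a24_frob g).
Proof.
have : all (fun g => a24_valid (a24_frob g)) a24_enum by vm_compute.
by rewrite -(mem_a24_enum g) => /allP; apply.
Qed.

Section Evaluation.
Variables (K : fieldType) (L : closedFieldType) (iota : {rmorphism K -> L}).
Hypothesis L2 : 2 \in [pchar L].
Variable omega : L.
Hypothesis omega_root : omega ^+ 2 + omega + 1 = 0.
Local Notation E := (curve K).
Local Notation aut := (@geom_iso K L iota E E).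

Let two0 : 2 = 0 :> L. Proof. exact: pcharf0 L2. Qed.

Let addxx (x : L) : x + x = 0.
Proof.
by rewrite -mulr2n -mulr_natl two0 mul0r.
Qed.

Lemma omega2 : omega ^+ 2 = 1 + omega.
Proof.
by apply: (eq_mod2 L2 (z := - omega - 1)); apply/subr0_eq; rewrite -omega_root;
  ring.
Qed.

Definition f4_val (x : F4) : L := x.1%:R + x.2%:R * omega.

Lemma f4_val0 : f4_val f4_0 = 0. Proof. by rewrite /f4_val /= mul0r addr0. Qed.
Lemma f4_val1 : f4_val f4_1 = 1. Proof. by rewrite /f4_val /= mul0r addr0. Qed.
Lemma f4_valw : f4_val f4_w = omega.
Proof.
by rewrite /f4_val /= mul1r add0r.
Qed.
Lemma f4_valw2 : f4_val f4_w2 = omega ^+ 2.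
Proof.
by rewrite /f4_val /= mul1r omega2.
Qed.

Lemma natr_addb (b c : bool) : (b (+) c)%:R = b%:R + c%:R :> L.
Proof. by case: b; case: c; rewrite ?addr0 ?add0r ?addxx. Qed.

Lemma natr_andb (b c : bool) : (b && c)%:R = b%:R * c%:R :> L.
Proof. by case: b; case: c; rewrite /= ?mulr1 ?mulr0. Qed.

Lemma f4_valD x y : f4_val (f4_add x y) = f4_val x + f4_val y.
Proof. by rewrite /f4_val /= !natr_addb; ring. Qed.

Lemma f4_valM x y : f4_val (f4_mul x y) = f4_val x * f4_val y.
Proof.
rewrite /f4_val /= !natr_addb !natr_andb.
transitivity (x.1%:R * y.1%:R + x.2%:R * y.2%:R * (1 + omega) +
  (x.1%:R * y.2%:R + x.2%:R * y.1%:R) * omega).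
  by ring.
by rewrite -omega2; ring.
Qed.

Lemma f4_valX2 x : f4_val (f4_sqr x) = f4_val x ^+ 2.
Proof. by rewrite f4_valM expr2. Qed.

Lemma f4_val_eq0 x : (f4_val x == 0) = (x == f4_0).
Proof.
have w0 : omega != 0.
  by apply/eqP => w; move/eqP: omega_root; rewrite w expr0n !add0r oner_eq0.
case: x => [[] []]; rewrite ?f4_val0 ?f4_val1 ?f4_valw ?f4_valw2 ?eqxx ?oner_eq0
  ?(negPf w0) //.
by rewrite expf_eq0 /= (negPf w0).
Qed.

Lemma f4_val_inj : injective f4_val.
Proof.
move=> x y e; have : f4_val (f4_add x y) == 0 by rewrite f4_valD e addxx.
by rewrite f4_val_eq0; case: x {e} => [[] []]; case: y => [[] []].
Qed.

Lemma f4_val_pow4 x : f4_val x ^+ 4 = f4_val x.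
Proof.
rewrite -[4%N]/(2 * 2)%N exprM -!f4_valX2; congr f4_val.
by case: x => [[] []].
Qed.

Lemma f4_val_surj (x : L) : x ^+ 4 = x -> exists y, x = f4_val y.
Proof.
move=> x4; have : x * (x - 1) * (x - omega) * (x - omega ^+ 2) = 0.
  transitivity (x ^+ 4 - x - (omega ^+ 2 + omega + 1) *
    (x ^+ 3 - x ^+ 2 * (1 + omega - 1) + x ^+ 1 * (omega - 1))).
    by ring.
  by rewrite x4 omega_root subrr mul0r subr0.
move/eqP; rewrite !mulf_eq0 !subr_eq0 -!orbA => /or4P[] /eqP ->.
- by exists f4_0; rewrite f4_val0.
- by exists f4_1; rewrite f4_val1.
- by exists f4_w; rewrite f4_valw.
- by exists f4_w2; rewrite f4_valw2.
Qed.

Definition a24_change (g : A24) : change L :=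
  Phi_change (f4_val g.1.1) (f4_val g.1.2) (f4_val g.2).

Definition a24_fun (g : A24) : point iota E -> point iota E :=
  Phi iota (f4_val g.1.1) (f4_val g.1.2) (f4_val g.2).

Lemma a24_validE (u r t : F4) :
  a24_valid (u, r, t) = Phi_valid (f4_val u) (f4_val r) (f4_val t).
Proof.
rewrite /Phi_valid !f4_val_pow4 !eqxx /= f4_val_eq0; congr (_ && _).
by rewrite -f4_val_eq0 !f4_valD f4_valM !f4_valX2 -exprS.
Qed.

Lemma a24_fun_change g : a24_valid g -> change_of (a24_fun g) (a24_change g).
Proof.
by case: g => [[u r] t]; rewrite a24_validE => /(change_of_Phi L2); apply.
Qed.

Lemma a24_fun_aut g : a24_valid g -> aut (a24_fun g).
Proof.
case: g => [[u r] t]; rewrite a24_validE => valid; apply/(automorphism_PhiP L2).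
by exists (f4_val u), (f4_val r), (f4_val t).
Qed.

Lemma aut_a24_fun f : aut f -> exists2 g, a24_valid g & f =1 a24_fun g.
Proof.
move/(automorphism_PhiP L2) => [u [r [t [valid e]]]].
have [/f4_val_surj[u' eu] /f4_val_surj[r' er] /f4_val_surj[t' et]] :=
  Phi_valid_pow4 L2 valid.
exists (u', r', t'); first by rewrite a24_validE -eu -er -et.
by rewrite /a24_fun /= -eu -er -et.
Qed.

Lemma a24_fun_inj g h : a24_valid g -> a24_valid h -> a24_fun g =1 a24_fun h ->
  g = h.
Proof.
move=> gv hv e.
have := change_of_inj (a24_fun_change gv)
  ((change_of_eq _ (a24_fun_change hv)).2 (fsym e)).
case: g h {gv hv e} => [[u r] t] [[u' r'] t'] [] /(sqr_inj2 L2)/f4_val_inj ->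
  /f4_val_inj ->.
by move=> _ /f4_val_inj ->.
Qed.

Lemma a24_fun_mul g h : a24_valid g -> a24_valid h ->
  a24_fun (a24_mul g h) =1 a24_fun g \o a24_fun h.
Proof.
move=> gv hv; apply/(change_of_eq _ (a24_fun_change (a24_valid_mul gv hv))) =>
  P.
rewrite /= (a24_fun_change gv) (a24_fun_change hv) -change_map_comp;
  congr change_map.
case: g h gv hv => [[u r] t] [[u' r'] t'] /= gv hv.
have u3 : f4_val u ^+ 3 = 1 by apply: (@Phi_cube L _ (f4_val r) (f4_val t));
  rewrite -a24_validE.
rewrite /change_comp /a24_change /Phi_change /= !f4_valD !f4_valM; congr Change.
- by ring.
- by rewrite mulr1.
- apply/esym.
  pose z := f4_val u ^+ 4 * f4_val u' ^+ 2 * f4_val r * f4_val r'.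
  apply: (eq_mod2 L2 (z := z)); rewrite /z.
  transitivity (f4_val u ^+ 3 * f4_val u ^+ 3 *
    (f4_val u' ^+ 2 * f4_val r' ^+ 2)
    + f4_val u ^+ 2 * f4_val u' ^+ 2 * f4_val r ^+ 2
    + 2 * (f4_val u ^+ 4 * f4_val u' ^+ 2 * f4_val r * f4_val r'));
      first by ring.
  by rewrite u3; ring.
- by ring.
Qed.

Lemma a24_fun_one : a24_fun a24_one =1 id.
Proof.
move=> P; apply: val_inj; rewrite (a24_fun_change (g := a24_one)) //.
rewrite /a24_change /= f4_val0 f4_val1; case: (val P) => [[x y]|] //=.
by rewrite !(expr1n, expr0n, mul1r, mul0r, addr0).
Qed.

Lemma a24_fun_frob (s : galois_elt iota) g :
  (forall x, s (f4_val x) = f4_val (f4_sqr x)) -> a24_valid g ->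
  gal_conj s (a24_fun g) =1 a24_fun (a24_frob g).
Proof.
move=> sF gv; apply/(change_of_eq _ (change_of_gal s (a24_fun_change gv))).
have := a24_fun_change (a24_valid_frob gv); case: g gv => [[u r] t] _.
by rewrite /map_change /a24_change /= !(rmorphM, rmorphXn, rmorph1) /= !sF.
Qed.

(** Existence and uniqueness in decidable form: the index of the first
    representative equivalent to g is the only one. *)
Definition a24_representatives (eqv : rel A24) (reps : seq A24) : bool :=
  all a24_valid reps && all (fun g => let k := find (eqv g) reps in
    (k < size reps)%N &&
    all (fun i => (i == k) || ~~ eqv g (nth a24_one reps i))
        (seq.iota 0 (size reps))) a24_enum.

Lemma representatives_a24 
    (R : (point iota E -> point iota E) -> (point iota E -> point iota E) ->
      Prop)
    (eqv : rel A24) m (reps : m.-tuple A24) :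
  (forall f g h, a24_valid g -> a24_valid h -> f =1 a24_fun g ->
    R f (a24_fun h) <-> eqv g h) ->
  a24_representatives eqv reps ->
  representatives aut R (map_tuple a24_fun reps).
Proof.
move=> RE /andP[/allP reps_valid /allP reps_ok].
have val_i (i : 'I_m) : a24_valid (tnth reps i) by apply/reps_valid/mem_tnth.
split=> [i|f /aut_a24_fun[g gv fg]]; first by rewrite tnth_map;
  apply: a24_fun_aut.
have := reps_ok g; rewrite mem_a24_enum => /(_ gv) /andP[lt_k /allP k_uniq].
have k_reps := nth_find a24_one (etrans (has_find _ _) lt_k).
rewrite size_tuple in lt_k k_uniq; exists (Ordinal lt_k); split=> [|i].
  by rewrite tnth_map; apply/(RE _ g); rewrite // (tnth_nth a24_one).
rewrite tnth_map => /(RE _ g _ gv (val_i i) fg);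
  rewrite (tnth_nth a24_one) => gi.
have := k_uniq i; rewrite mem_iota ltn_ord => /(_ isT);
  rewrite gi orbF => /eqP ik.
exact: val_inj.
Qed.

End Evaluation.

(** In the following definitions, fr is the action of Frobenius on the model:
    trivial if n is even, and squaring of the parameters if n is odd. They
    mirror [frob_conj], [frob_norm] and [splits_degree]. *)
Definition a24_frob_conj (fr : A24 -> A24) (g h : A24) : bool :=
  has (fun s => a24_mul s h == a24_mul g (fr s)) a24_enum.

Fixpoint a24_norm (fr : A24 -> A24) (g : A24) (e : nat) : A24 :=
  if e is e'.+1 then a24_mul (fr (a24_norm fr g e')) g else a24_one.

Definition a24_splits_at (fr : A24 -> A24) (g : A24) (e : nat) : bool :=
  has (fun a => iter e fr a == a24_mul (a24_norm fr g e) a) a24_enum.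

Definition a24_degree (fr : A24 -> A24) (g : A24) (d : nat) : bool :=
  [&& a24_valid g, (0 < d)%N, a24_splits_at fr g d
    & all (fun e => ~~ a24_splits_at fr g e) (seq.iota 1 d.-1)].

Section Frobenius.
Variables (K : finFieldType) (L : closedFieldType) (iota : {rmorphism K -> L}).
Hypothesis L2 : 2 \in [pchar L].
Variable omega : L.
Hypothesis omega_root : omega ^+ 2 + omega + 1 = 0.
Local Notation E := (curve K).
Local Notation ev := (@a24_fun K L iota omega).
Local Notation aut := (@automorphism K L iota E).

Variable fr : A24 -> A24.
Hypothesis fr_valid : forall g, a24_valid g -> a24_valid (fr g).
Hypothesis frE : forall g, a24_valid g ->
  gal_conj (frobenius iota) (ev g) =1 ev (fr g).
Hypothesis frob2_aut : forall alpha, aut alpha ->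
  gal_conj (frobenius iota) (gal_conj (frobenius iota) alpha) =1 alpha.

Let ev_mul g h := @a24_fun_mul K L iota L2 omega omega_root g h.
Let ev_inj g h := @a24_fun_inj K L iota L2 omega omega_root g h.
Let ev_aut g := @a24_fun_aut K L iota L2 omega omega_root g.

Lemma frob_conj_a24 g h : a24_valid g -> a24_valid h ->
  frob_conj (ev g) (ev h) <-> a24_frob_conj fr g h.
Proof.
move=> gv hv; split=> [[s /(aut_a24_fun L2 omega_root)[a av sa] e]|/hasP[a]].
  apply/hasP; exists a; first by rewrite mem_a24_enum.
  apply/eqP; apply: ev_inj;
    [exact: a24_valid_mul | exact: a24_valid_mul (fr_valid _) |].
  move=> P; rewrite !ev_mul ?fr_valid //= -frE // -(eq_gal_conj _ sa) -sa.
  exact: e.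
rewrite mem_a24_enum => av /eqP e; exists (ev a); first exact: ev_aut.
by move=> P; rewrite -ev_mul // e ev_mul ?fr_valid //= frE.
Qed.

Lemma norm_a24 g e : a24_valid g ->
  a24_valid (a24_norm fr g e) /\ frob_norm (ev g) e =1 ev (a24_norm fr g e).
Proof.
move=> gv; elim: e => [|e [nv ne]]; first by split=> // P; rewrite a24_fun_one.
split=> /=; first by apply: a24_valid_mul gv; apply: fr_valid.
by move=> P; rewrite ev_mul ?fr_valid //= (eq_gal_conj _ ne) frE.
Qed.

Lemma gal_conj_pow_a24 g e : a24_valid g ->
  a24_valid (iter e fr g) /\
    gal_conj (galois_pow (frobenius iota) e) (ev g) =1 ev (iter e fr g).
Proof.
move=> gv; elim: e => [|e [iv ie]]; first by split=> // P; rewrite gal_conj_one.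
split=> /=; first exact: fr_valid.
by move=> P; rewrite gal_conj_powS (eq_gal_conj _ ie) frE.
Qed.

Lemma splits_at_a24 g e : a24_valid g ->
  (exists2 alpha, aut alpha &
     gal_conj (galois_pow (frobenius iota) e) alpha =1 frob_norm (ev g) e \o
       alpha)
  <-> a24_splits_at fr g e.
Proof.
move=> gv; have [nv ne] := norm_a24 e gv.
split=> [[s /(aut_a24_fun L2 omega_root)[a av sa] es]|/hasP[a]].
  apply/hasP; exists a; first by rewrite mem_a24_enum.
  have [iv ie] := gal_conj_pow_a24 e av.
  apply/eqP; apply: ev_inj => //; first exact: a24_valid_mul.
  by move=> P; rewrite ev_mul //= -ie -ne -sa -(eq_gal_conj _ sa); apply: es.
rewrite mem_a24_enum => av /eqP ea; exists (ev a); first exact: ev_aut.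
have [iv ie] := gal_conj_pow_a24 e av.
by move=> P; rewrite ie ea ev_mul //= ne.
Qed.

Lemma twist_degree_a24 g d : a24_degree fr g d -> twist_degree (ev g) d.
Proof.
move=> /and4P[gv d0 at_d /allP below_d].
apply: (twist_degree_norm frob2_aut (lang_curve L2)) => //; first exact: ev_aut.
  exact/splits_at_a24.
move=> e al lt_ed al_aut al_e; have := below_d e.
rewrite mem_iota add1n prednK // => /(_ lt_ed) /negP[].
by apply/splits_at_a24 => //; exists al.
Qed.

Lemma frob_class_representatives m (reps : m.-tuple A24) :
  a24_representatives (a24_frob_conj fr) reps ->
  representatives aut (same_class (@frob_class K L iota E)) (map_tuple ev reps).
Proof.
apply: representatives_a24 => // f g h gv hv fg; rewrite -frob_conj_a24 //.
rewrite same_classP; split; apply: frob_conj_ext => //; exact: fsym.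
Qed.

End Frobenius.

(** * The classification *)

Lemma discriminant_curve (F : fieldType) : discriminant (curve F) = 1 - 2 * 14.
Proof. by rewrite /discriminant /wb2 /wb4 /wb6 /wb8 /=; ring. Qed.

Lemma curve_F2_invariants : elliptic (curve 'F_2) /\
  j_invariant (curve 'F_2) = 0.
Proof.
have two0 : 2 = 0 :> 'F_2 by apply: val_inj.
split; first by rewrite /elliptic discriminant_curve two0 mul0r subr0 oner_eq0.
rewrite /j_invariant (_ : wc4 _ = 0); first by rewrite expr0n mul0r.
by rewrite /wc4 /wb2 /wb4 /= two0 !(mul0r, mulr0, expr0n, addr0) subrr.
Qed.

Section Classification.
Variables (n : nat) (K : finFieldType) (L : closedFieldType).
Variables (iota : {rmorphism K -> L}) (omega : L).
Hypotheses (n_gt0 : (1 <= n)%N) (cardK : #|K| = (2 ^ n)%N).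
Hypothesis omega3 : 3.-primitive_root omega.
Local Notation E := (curve K).
Local Notation phi := (Phi iota).
Local Notation ev := (@a24_fun K L iota omega).
Local Notation aut := (@automorphism K L iota E).

Lemma pchar2_card : 2 \in [pchar L].
Proof.
have [p p_pr pK] := finPcharP K; rewrite (fmorph_pchar iota).
have [k qk] : exists k, #|K| = (p ^ k)%N by eexists; apply: card_pprimeChar.
have p2 : (2 %| p ^ k)%N by rewrite -qk cardK dvdn_exp.
have : (2 %| p)%N by move: p2; rewrite Euclid_dvdX // => /andP[].
by rewrite dvdn_prime2 // => /eqP e; move: pK; rewrite -e.
Qed.

Lemma omega_root : omega ^+ 2 + omega + 1 = 0.
Proof.
have nz : omega - 1 != 0 by
  rewrite subr_eq0 -[omega]expr1 -(prim_order_dvd omega3).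
apply: (mulfI nz); rewrite mulr0.
by transitivity (omega ^+ 3 - 1);
  [ring | rewrite (prim_expr_order omega3) subrr].
Qed.

Lemma pow_pow4 (x : L) m : x ^+ 4 = x -> x ^+ (4 ^ m) = x.
Proof. by move=> x4; elim: m => [|m IHm]; rewrite ?expr1 // expnS exprM x4. Qed.

(** The square of q is a power of 4. *)
Lemma frob_frob_aut alpha : aut alpha ->
  gal_conj (frobenius iota) (gal_conj (frobenius iota) alpha) =1 alpha.
Proof.
move=> alpha_aut P.
rewrite -[RHS](aut_fixed pchar2_card (s :=
  galois_pow (frobenius iota) 2) _ alpha_aut).
  rewrite gal_conj_powS; apply/esym/eq_gal_conj => Q.
  by rewrite gal_conj_powS; apply/eq_gal_conj/gal_conj_one.
by move=> x x4; rewrite frobenius_powE cardK -expnM mulnC expnM pow_pow4.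
Qed.

Lemma representatives_24 : exists c : 24.-tuple (point iota E -> point iota E),
  representatives aut (fun f g => f =1 g) c.
Proof.
have size24 : size a24_enum == 24 by vm_compute.
exists (map_tuple ev (Tuple size24)).
apply: (representatives_a24 pchar2_card omega_root (eqv := eq_op));
  last by vm_compute.
move=> f g h gv hv fg; split=> [fh|/eqP <-] //; apply/eqP.
apply: (a24_fun_inj (iota := iota) pchar2_card omega_root gv hv) => P;
  by rewrite -fg fh.
Qed.

Section Even.
Hypothesis n_even : ~~ odd n.

(** When n is even, q is a power of 4 and F_4 is contained in K. *)
Lemma galois_aut_even (s : galois_elt iota) f : aut f -> gal_conj s f =1 f.
Proof.
apply: (aut_fixed pchar2_card) => x x4.
have [y ->] : exists y, x = iota y; last exact: gal_fix.
apply/fixed_by_power; rewrite cardK -(odd_double_half n) (negPf n_even) add0n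
  -mul2n expnM.
exact: pow_pow4.
Qed.

Lemma conj_class_even tau f : frob_class tau f <->
  conj_class (iota := iota) (E := E) tau f.
Proof.
by split=> -[s [s' [s_aut sK s'K e]]]; exists s, s'; split=> // P;
  rewrite e /= galois_aut_even.
Qed.

Let fr_valid g : a24_valid g -> a24_valid (id g). Proof. by []. Qed.
Let frE g (gv : a24_valid g) : gal_conj (frobenius iota) (ev g) =1 ev (id g).
Proof. exact/galois_aut_even/(a24_fun_aut _ pchar2_card omega_root). Qed.

Definition even_reps : 7.-tuple A24 :=
  [tuple a24_one; (f4_1, f4_0, f4_1); (f4_w2, f4_0, f4_1); (f4_w, f4_0, f4_1);
         (f4_w, f4_0, f4_0); (f4_w2, f4_0, f4_0); (f4_1, f4_1, f4_w)].

Lemma frob_representatives_even :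
  representatives aut (same_class (@frob_class K L iota E))
    (map_tuple ev even_reps).
Proof.
apply: (frob_class_representatives pchar2_card omega_root fr_valid frE).
by vm_compute.
Qed.

Lemma twist_degree_even g d : a24_degree id g d -> twist_degree (ev g) d.
Proof.
exact: (twist_degree_a24 pchar2_card omega_root fr_valid frE frob_frob_aut).
Qed.

End Even.

Section Odd.
Hypothesis n_odd : odd n.

(** When n is odd, q is twice a power of 4. *)
Lemma frobenius_f4 x : frobenius iota (f4_val omega x) =
  f4_val omega (f4_sqr x).
Proof.
rewrite /= /frob_fun cardK -(odd_double_half n) n_odd -mul2n expnD expnM mulnC
  exprM.
rewrite pow_pow4; last exact: (f4_val_pow4 pchar2_card omega_root).
by rewrite expn1 -(f4_valX2 pchar2_card omega_root).
Qed.

Let frE g (gv : a24_valid g) :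
  gal_conj (frobenius iota) (ev g) =1 ev (a24_frob g).
Proof. exact: (a24_fun_frob pchar2_card omega_root frobenius_f4 gv). Qed.

Definition odd_reps : 3.-tuple A24 :=
  [tuple a24_one; (f4_1, f4_w, f4_w); (f4_1, f4_w, f4_w2)].

Lemma frob_representatives_odd :
  representatives aut (same_class (@frob_class K L iota E))
    (map_tuple ev odd_reps).
Proof.
apply: (frob_class_representatives pchar2_card omega_root a24_valid_frob frE).
by vm_compute.
Qed.

Lemma twist_degree_odd g d : a24_degree a24_frob g d -> twist_degree (ev g) d.
Proof.
exact: (twist_degree_a24 pchar2_card omega_root a24_valid_frob frE
  frob_frob_aut).
Qed.

Lemma galois_aut_odd : exists (s : galois_elt iota) f, aut f /\
  ~ gal_conj s f =1 f.
Proof.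
pose g : A24 := (f4_w, f4_0, f4_0); have gv : a24_valid g by [].
exists (frobenius iota), (ev g); split;
  first exact: (a24_fun_aut _ pchar2_card omega_root gv).
move=> e; suff : a24_frob g = g by [].
have gFv := a24_valid_frob gv.
by apply: (a24_fun_inj (iota := iota) pchar2_card omega_root gFv gv) => P;
  rewrite -frE.
Qed.

End Odd.

Let ev1 u r t : ev (u, r, t) =
  phi (f4_val omega u) (f4_val omega r) (f4_val omega t).
Proof. by []. Qed.

Let f4E := (f4_val0 omega, f4_val1 omega, f4_valw omega,
  f4_valw2 pchar2_card omega_root).

Lemma odd_repsE : map_tuple ev odd_reps =
  [tuple phi 1 0 0; phi 1 omega omega; phi 1 omega (omega ^+ 2)].
Proof. by apply: val_inj; rewrite /= /a24_one !ev1 !f4E. Qed.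

Lemma even_repsE : map_tuple ev even_reps =
  [tuple phi 1 0 0; phi 1 0 1; phi (omega ^+ 2) 0 1; phi omega 0 1;
         phi omega 0 0; phi (omega ^+ 2) 0 0; phi 1 1 omega].
Proof. by apply: val_inj; rewrite /= /a24_one !ev1 !f4E. Qed.

Lemma twist_degree_odd_reps : odd n ->
  forall i d, a24_degree a24_frob (tnth odd_reps i) d ->
  twist_degree (tnth [tuple phi 1 0 0; phi 1 omega omega;
    phi 1 omega (omega ^+ 2)] i) d.
Proof.
by move=> n_odd i d; rewrite -odd_repsE tnth_map; apply: twist_degree_odd.
Qed.

Lemma twist_degree_even_reps : ~~ odd n ->
  forall i d, a24_degree id (tnth even_reps i) d ->
  twist_degree (tnth [tuple phi 1 0 0; phi 1 0 1; phi (omega ^+ 2) 0 1;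
    phi omega 0 1; phi omega 0 0; phi (omega ^+ 2) 0 0; phi 1 1 omega] i) d.
Proof.
by move=> n_even i d; rewrite -even_repsE tnth_map; apply: twist_degree_even.
Qed.

Lemma Phi_one : phi 1 0 0 =1 id.
Proof.
by have := a24_fun_one (iota := iota) pchar2_card omega_root;
  rewrite /a24_one ev1 !f4E.
Qed.

End Classification.

Theorem proposition3p1
    (n : nat) (K : finFieldType) (L : closedFieldType)
    (iota : {rmorphism K -> L}) (omega : L) :
  (1 <= n)%N ->
  #|K| = (2 ^ n)%N ->
  integralRange iota ->
  3.-primitive_root omega ->
  let E := curve K in
  let phi := Phi iota in
  let C := @frob_class K L iota E in
  (elliptic (curve 'F_2) /\ j_invariant (curve 'F_2) = 0) /\
  (exists c : 24.-tuple (point iota E -> point iota E),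
     representatives (@automorphism K L iota E) (fun f g => f =1 g) c) /\
  (forall u r t, Phi_valid u r t ->
     forall P, val (phi u r t P) = Phi_formula u r t (val P)) /\
  (forall f : point iota E -> point iota E,
     automorphism f <->
     exists u r t, Phi_valid u r t /\ f =1 phi u r t) /\
  (~~ odd n ->
     forall (s : galois_elt iota) (f : point iota E -> point iota E),
       automorphism f -> gal_conj s f =1 f) /\
  (odd n ->
     exists (s : galois_elt iota) (f : point iota E -> point iota E),
       automorphism f /\ ~ (gal_conj s f =1 f)) /\
  (odd n ->
     representatives (@automorphism K L iota E) (same_class C)
       [tuple phi 1 0 0; phi 1 omega omega; phi 1 omega (omega ^+ 2)] /\
     (forall Etw, nontrivial_twist iota E Etw <->
        corresponds (phi 1 omega omega) Etw \/
        corresponds (phi 1 omega (omega ^+ 2)) Etw) /\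
     twist_degree (phi 1 omega omega) 8 /\
     twist_degree (phi 1 omega (omega ^+ 2)) 8) /\
  (~~ odd n ->
     (forall tau f : point iota E -> point iota E,
        automorphism tau -> (C tau f <-> conj_class tau f)) /\
     representatives (@automorphism K L iota E)
       (same_class (@conj_class K L iota E))
       [tuple phi 1 0 0; phi 1 0 1; phi (omega ^+ 2) 0 1; phi omega 0 1;
              phi omega 0 0; phi (omega ^+ 2) 0 0; phi 1 1 omega] /\
     twist_degree (phi 1 0 0) 1 /\
     twist_degree (phi 1 0 1) 2 /\
     twist_degree (phi (omega ^+ 2) 0 1) 6 /\
     twist_degree (phi omega 0 1) 6 /\
     twist_degree (phi omega 0 0) 3 /\
     twist_degree (phi (omega ^+ 2) 0 0) 3 /\
     twist_degree (phi 1 1 omega) 4) /\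
  (odd n ->
     exists T : 2.-tuple (weierstrass K),
       representatives (nontrivial_twist iota E) (rational_isomorphic iota) T) /\
  (~~ odd n ->
     exists T : 6.-tuple (weierstrass K),
       representatives (nontrivial_twist iota E) (rational_isomorphic iota) T).
Proof.
move=> n_gt0 cardK _ omega3 E phi C.
have L2 := pchar2_card iota n_gt0 cardK; have w_root := omega_root omega3.
have frob2 := frob_frob_aut (iota := iota) n_gt0 cardK.
have lang := lang_curve (iota := iota) L2.
have id1 := Phi_one (iota := iota) n_gt0 cardK omega3.
split; first exact: curve_F2_invariants.
split; first exact: (representatives_24 iota n_gt0 cardK omega3).
split; first by move=> u r t valid P; apply: val_Phi.
split; first by move=> f; apply: automorphism_PhiP.
split; first by move=> n_even s f; apply: (galois_aut_even n_gt0 cardK).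
split; first by move=> n_odd;
  apply: (galois_aut_odd iota n_gt0 cardK omega3 n_odd).
split.
  move=> n_odd.
  have := frob_representatives_odd iota n_gt0 cardK omega3 n_odd.
  rewrite (odd_repsE iota n_gt0 cardK omega3);
    set c := (c in representatives _ _ c) => reps.
  have c0 : tnth c ord0 =1 id by exact: id1.
  have deg := twist_degree_odd_reps iota n_gt0 cardK omega3 n_odd.
  split=> //; split.
    move=> Etw; split=> [/(nontrivial_twistP frob2 c0 reps)[]|tw].
      by case=> -[|[|[|//]]] lt_i // _; [left | right].
    apply/(nontrivial_twistP frob2 c0 reps).
    by case: tw => tw; [exists (@Ordinal 3 1 isT) | exists (@Ordinal 3 2 isT)].
  split; first by apply: (deg (@Ordinal 3 1 isT)); vm_compute.
  by apply: (deg (@Ordinal 3 2 isT)); vm_compute.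
split.
  move=> n_even.
  have := frob_representatives_even iota n_gt0 cardK omega3 n_even.
  rewrite (even_repsE iota n_gt0 cardK omega3) => -[reps_aut reps].
  have deg := twist_degree_even_reps iota n_gt0 cardK omega3 n_even.
  have conjE := @conj_class_even n K L iota n_gt0 cardK n_even.
  split; first by move=> tau f _; apply: conjE.
  split.
    split=> // f /reps[i [fi i_uniq]]; exists i; split=> [|k fk].
      by move=> z; rewrite -!conjE.
    by apply: i_uniq => z; rewrite !conjE.
  split; first by apply: (deg (@Ordinal 7 0 isT)); vm_compute.
  split; first by apply: (deg (@Ordinal 7 1 isT)); vm_compute.
  split; first by apply: (deg (@Ordinal 7 2 isT)); vm_compute.
  split; first by apply: (deg (@Ordinal 7 3 isT)); vm_compute.
  split; first by apply: (deg (@Ordinal 7 4 isT)); vm_compute.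
  split; first by apply: (deg (@Ordinal 7 5 isT)); vm_compute.
  by apply: (deg (@Ordinal 7 6 isT)); vm_compute.
split=> [n_odd|n_even].
  have := frob_representatives_odd iota n_gt0 cardK omega3 n_odd.
  rewrite (odd_repsE iota n_gt0 cardK omega3).
  by apply: (twist_representatives frob2 lang); exact: id1.
have := frob_representatives_even iota n_gt0 cardK omega3 n_even.
rewrite (even_repsE iota n_gt0 cardK omega3).
by apply: (twist_representatives frob2 lang); exact: id1.
Qed.
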